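(* Suppose that $G$ is an open set in $\mathbb{C}$ with connected components $\{G_n\}_{n\in J}$, that $\mathcal{H}$ is a reproducing kernel Hilbert space of analytic functions on $G$, and that $\varphi$ is a multiplier of $\mathcal{H}$. If $\varphi$ is non-constant on every component of $G$ and $\varphi(G_n)\cap\{z\in\mathbb{C} : |z|>1\}\neq\emptyset$ for every $n\in J$, then the operator $M_\varphi^*$ is convex-cyclic on $\mathcal{H}$ and has a dense set of convex-cyclic vectors.
   Context: A reproducing kernel Hilbert space $\mathcal{H}$ of analytic functions on $G$ is a (complex) vector space of analytic functions on $G$, complete with respect to a norm given by an inner product, such that point evaluations at all points of $G$ are continuous linear functionals on $\mathcal{H}$, and such that $f=0$ in $\mathcal{H}$ if and only if $f(z)=0$ for all $z\in G$. A multiplier of $\mathcal{H}$ is an analytic function $\varphi$ on $G$ such that $\varphi f\in\mathcal{H}$ for every $f\in\mathcal{H}$; then $M_\varphi:\mathcal{H}\to\mathcal{H}$, $M_\varphi f=\varphi f$, is a bounded linear operator, and $M_\varphi^*$ is its Hilbert space adjoint. A vector $x$ is a convex-cyclic vector for an operator $T$ on $\mathcal{H}$ if the convex hull of $\{T^n x : n=0,1,2,\ldots\}$ is dense in $\mathcal{H}$; $T$ is convex-cyclic if it has a convex-cyclic vector. *)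

(* Defs.v *)
From HB Require Import structures.
From mathcomp Require Import all_boot all_order all_algebra.
From mathcomp Require Import complex.
From mathcomp Require Import all_classical all_reals all_analysis.

Set Implicit Arguments.
Unset Strict Implicit.
Unset Printing Implicit Defensive.

Import Order.TTheory GRing.Theory Num.Theory.
Import numFieldNormedType.Exports.

Local Open Scope classical_set_scope.
Local Open Scope ring_scope.

(* MathComp-Analysis puts the norm topology on any abstract
   [C : numClosedFieldType], but not on [complex R] itself. So the definitions
   below take such a [C], and are used at [C := cplx R]. *)
Definition cplx (R : realType) : numClosedFieldType := complex R.

(* Values of [f] outside [G] play no role when [G] is open. *)
Definition analytic_on (C : numClosedFieldType) (G : set C) (f : C -> C) : Prop :=
  forall z0 : C, G z0 -> exists a : nat -> C,
    \forall z \near z0, series (fun n => a n * (z - z0) ^+ n) @ \oo --> f z.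

Definition components (C : numClosedFieldType) (G : set C) : set (set C) :=
  connected_component G @` G.

(* The elements of the space are kept abstract: [ev f] is the function on [G]
   that [f] is, its values outside [G] being irrelevant. By [ev_scalar] the
   vector space operations are the pointwise ones, so that by [ev_eq0] an
   element is determined by its function. *)
Record rkhs (C : numClosedFieldType) (G : set C) := Rkhs {
  rkhs_space :> completeNormedModType C ;
  dot : {dot rkhs_space for @Num.conj C} ;
  dot_norm : forall f : rkhs_space, `|f| ^+ 2 = dot f f ;
  ev : rkhs_space -> C -> C ;
  ev_scalar : forall z : C, G z -> scalar (ev^~ z) ;
  ev_analytic : forall f : rkhs_space, analytic_on G (ev f) ;
  ev_continuous : forall z : C, G z -> continuous (ev^~ z) ;
  ev_eq0 : forall f : rkhs_space, f = 0 <-> (forall z : C, G z -> ev f z = 0) }.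

Definition is_product (C : numClosedFieldType) (G : set C) (H : rkhs G)
    (phi : C -> C) (f g : H) : Prop :=
  forall z : C, G z -> ev g z = phi z * ev f z.

Definition multiplier (C : numClosedFieldType) (G : set C) (H : rkhs G)
    (phi : C -> C) : Prop :=
  analytic_on G phi /\ forall f : H, exists g : H, is_product phi f g.

(* [0] is a default value, never used when [phi] is a multiplier of [H]. *)
Definition mul_op (C : numClosedFieldType) (G : set C) (H : rkhs G)
    (phi : C -> C) : H -> H :=
  fun f => xget 0 [set g | is_product phi f g].

(* [0] is a default value, never used when [C] is the field of complex numbers
   and [T] is bounded and linear. *)
Definition adjoint (C : numClosedFieldType) (G : set C) (H : rkhs G)
    (T : H -> H) : H -> H :=
  fun g => xget 0 [set h | forall f, dot H (T f) g = dot H f h].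

(* The scalars in [convex_set] are the [t : C] with [0 <= t <= 1]; these are
   real, so this is the convex hull in the usual sense. *)
Definition convex_hull (C : numClosedFieldType) (E : lmodType C) (A : set E) :
    set E :=
  smallest (@convex_set C E) A.

Definition convex_cyclic_vector (C : numClosedFieldType) (E : normedModType C)
    (T : E -> E) (x : E) : Prop :=
  dense (convex_hull [set iter n T x | n in [set: nat]]).

Definition convex_cyclic (C : numClosedFieldType) (E : normedModType C)
    (T : E -> E) : Prop :=
  exists x, convex_cyclic_vector T x.

(* Main.v *)
(** The kernel functions [k_z] are eigenvectors of the adjoint of [M_phi], with
    eigenvalue the conjugate of [phi z]. By the identity theorem, the [k_z] with
    [1 < |phi z|] already span a dense subspace, and since [phi] is nowhere
    locally constant one can choose countably many of them, still total, with
    non-real eigenvalues of pairwise distinct moduli. For finitely many such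
    numbers [l_i] there is a convex polynomial [p] (nonnegative coefficients of
    sum 1) with arbitrary prescribed values [p(l_i)]. Hence every finite
    combination of the eigenvectors with nonzero coefficients is sent by some
    convex polynomial in the adjoint to any other given combination of them,
    and Baire's theorem yields a dense set of convex-cyclic vectors.

    The interpolation: if [mu] is not real then [Re (mu^k) < 0] for some [k], so
    [(X^k - mu^k) (X^k - conj mu^k)] has nonnegative coefficients and vanishes at
    [mu], but not at numbers of another modulus. Such products allow one to
    treat the [l_i] separately, and to express any complex number as [h(mu)]
    with [h] having nonnegative coefficients; multiplying [h] by a high power of
    [X] makes the sum of the coefficients as small as wanted when [1 < |mu|]. *)
Require Import Defs.
From mathcomp Require Import all_boot all_order all_algebra.
From mathcomp Require Import complex.
From mathcomp Require Import all_classical all_reals all_analysis.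
From mathcomp Require Import ring lra.

Import Order.TTheory GRing.Theory Num.Theory.
Import numFieldNormedType.Exports.

Local Open Scope classical_set_scope.
Local Open Scope ring_scope.

(* These three properties are all that is used of the complex numbers beyond the
   structure of [numClosedFieldType], which is what carries the norm topology. *)
Definition archimedean (C : numClosedFieldType) :=
  forall x : C, exists n : nat, `|x| < n%:R.

Definition has_nneg_inf (C : numClosedFieldType) :=
  forall A : set C, A !=set0 -> (forall x, A x -> 0 <= x) ->
  exists2 m, (forall x, A x -> m <= x) & forall e, 0 < e -> exists2 x, A x & x < m + e.

Definition dense_seq (C : numClosedFieldType) (q : nat -> C) :=
  forall c e : C, 0 < e -> exists n, `|c - q n| < e.

(** * Complex numbers *)

Lemma archimedean_cplx (R : realType) : archimedean (cplx R).
Proof.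
move=> x; exists (Num.truncn (complex.Re `|x|)).+1.
have -> : `|x| = (complex.Re `|x|)%:C%C by rewrite RRe_real// normr_real.
rewrite -(rmorph_nat (real_complex R)) ltcR.
exact: truncnS_gt.
Qed.

(** Nonnegative complex numbers are real, so the infimum can be taken in [R] over the real parts. *)
Lemma has_nneg_inf_cplx (R : realType) : has_nneg_inf (cplx R).
Proof.
move=> A [x0 Ax0] A0; pose B := [set complex.Re x | x in A].
have AE x : A x -> x = (complex.Re x)%:C%C by move=> /A0/ger0_real x0R; rewrite RRe_real.
have hB : has_inf B.
  split; first by exists (complex.Re x0), x0.
  exists 0 => _ [x Ax <-]; have := A0 x Ax; rewrite (AE x Ax) ler0c; exact.
exists (inf B)%:C%C.
  move=> x Ax; rewrite (AE x Ax) lecR; apply: ge_inf; first exact: hB.2.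
  by exists x.
move=> e e0; have eE : e = (complex.Re e)%:C%C by rewrite RRe_real// gtr0_real.
have e0' : 0 < complex.Re e by move: e0; rewrite {1}eE ltcR.
have [_ [x Ax <-] xe] := inf_adherent e0' hB.
by exists x => //; rewrite (AE x Ax) eE -rmorphD ltcR.
Qed.

Lemma exists_dense_seq_cplx (R : realType) : exists q : nat -> cplx R, dense_seq _ q.
Proof.
(* The rational points of the plane, enumerated through their codes; a number that codes no pair is
   sent to [0]. *)
exists (fun n => if @unpickle (rat * rat)%type n is Some u
  then Complex (ratr u.1) (ratr u.2) else 0) => c e e0.
have eE : e = (complex.Re e)%:C%C by rewrite RRe_real// gtr0_real.
have e0' : 0 < complex.Re e by move: e0; rewrite {1}eE ltcR.
have approx (x : R) : exists u : rat, `|x - ratr u| < complex.Re e / 2.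
  have [|u] := @rat_in_itvoo R (x - complex.Re e / 2) (x + complex.Re e / 2).
    by rewrite ltrD2l gtrN ?divr_gt0.
  rewrite in_itv/= => /andP[h1 h2]; exists u; rewrite ltr_norml.
  by apply/andP; split; lra.
have [u Hu] := approx (complex.Re c); have [v Hv] := approx (complex.Im c).
exists (pickle (u, v)); rewrite pickleK /=.
have -> : c - Complex (ratr u) (ratr v) =
  (complex.Re c - ratr u)%:C%C + 'i%C * (complex.Im c - ratr v)%:C%C :> complex R.
  by case: c Hu Hv => a b /= _ _; simpc.
apply: le_lt_trans (ler_normD _ _) _.
have n1 : `|'i%C : complex R| = 1 by rewrite normc_def /= expr0n expr1n add0r sqrtr1.
rewrite normrM n1 mul1r.
have nr (x : R) : `|x%:C%C : complex R| = `|x|%:C%C.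
  by rewrite normc_def /= expr0n addr0 sqrtr_sqr.
by rewrite !nr -rmorphD eE ltcR; have := ltrD Hu Hv; rewrite -splitr.
Qed.

(** * Interpolation by convex polynomials *)

Section ConvexPolynomials.
Variable C : numClosedFieldType.
Hypothesis archi : archimedean C.
Implicit Types (mu u w : C) (p h : {poly C}).

Local Notation nnegp := (polyOver (@Num.Def.nneg_num_pred C)).

Lemma norm_Re_le u : `|'Re u| <= `|u|.
Proof. exact: (leif_normC_Re_Creal u).1. Qed.

Lemma norm_Im_le u : `|'Im u| <= `|u|.
Proof. by rewrite -normrN -ReMil (le_trans (norm_Re_le _))// normrM normCi mul1r. Qed.

(* If [Re (v ^ (2^n)) >= 0] for all [n], with [`|v| = 1], then each squaring at
   least doubles [1 - Re v], which stays at most [1]. *)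
Lemma Re_neg_pow mu : mu \isn't Num.real -> exists k, 'Re (mu ^+ k) < 0.
Proof.
move=> muNR.
have mu0 : mu != 0 by apply: contraNneq muNR => ->; rewrite real0.
pose v := mu / `|mu|.
have vn : `|v| = 1 by rewrite normrM normfV normr_id divff ?normr_eq0.
have vNR : v \isn't Num.real.
  apply: contra muNR => vR.
  by rewrite -[mu](@divfK _ `|mu|) ?normr_eq0// rpredM// normr_real.
pose c n := 'Re (v ^+ (2 ^ n)).
have cR n : c n \is Num.real by exact: Creal_Re.
have vv n : v ^+ n * (v ^+ n)^* = 1 by rewrite -normCK normrX vn !expr1n.
(* [c n] is the cosine of [2 ^ n] times the argument of [v], and this is the double-angle
   formula. *)
have cS n : c n.+1 = c n ^+ 2 * 2 - 1.
  rewrite /c !ReE expnS mulnC exprM rmorphXn /=.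
  set z := v ^+ _; have zz : z * z^* = 1 by exact: vv.
  have -> : ((z + z^*) / 2) ^+ 2 * 2 = (z ^+ 2 + z^* ^+ 2 + 2 * (z * z^*)) / 2.
    by field.
  by rewrite zz; field.
(* Strict, because [|'Re v| = |v|] holds only for real [v]. *)
have c01 : 0 < 1 - c 0%N.
  rewrite subr_gt0 /c expr1 (le_lt_trans (real_ler_norm (Creal_Re v)))//.
  by rewrite -vn (lt_leif (leif_normC_Re_Creal v)).
have [k ck] : exists k, c k < 0.
  apply: contrapT => /forallNP cN.
  have c_ge0 k : 0 <= c k.
    by have := cN k; case: real_ltP => //; rewrite ?real0.
  have grow k : 2 ^+ k * (1 - c 0%N) <= 1 - c k.
    elim: k => [|k IHk]; first by rewrite expr0 mul1r.
    rewrite exprS -mulrA; apply: (@le_trans _ _ (2 * (1 - c k))).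
      by rewrite ler_pM2l.
    rewrite cS -subr_ge0.
    have -> : 1 - (c k ^+ 2 * 2 - 1) - 2 * (1 - c k) = 2 * (c k * (1 - c k)).
      by ring.
    rewrite !mulr_ge0//.
    by apply: le_trans IHk; rewrite mulr_ge0 ?exprn_ge0// ltW.
  have [n] := archi (1 - c 0%N)^-1.
  rewrite normfV gtr0_norm// => Hn.
  have : n%:R <= (1 - c 0%N)^-1.
    rewrite -[leRHS]mul1r ler_pdivlMr// (le_trans _ (_ : 1 - c n <= 1))//.
      apply: le_trans (grow n); rewrite ler_pM2r//.
      by rewrite -natrX ler_nat ltnW// ltn_expl.
    by rewrite gerBl.
  by move=> /(lt_le_trans Hn); rewrite ltxx.
exists (2 ^ k)%N; move: ck; rewrite /c /v exprMn exprVn.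
rewrite mulrC ReMl ?rpredV ?rpredX ?normr_real//.
by rewrite pmulr_rlt0// invr_gt0 exprn_gt0// normr_gt0.
Qed.


(* Take [(X^k - mu^k) (X^k - conj (mu^k))] with [k] as in [Re_neg_pow]. *)
Lemma nneg_poly_root mu : mu \isn't Num.real ->
  exists p, [/\ p \is a nnegp, p.[mu] = 0, 0 < p.[1] &
    forall u, `|u| != `|mu| -> p.[u] != 0].
Proof.
move=> muNR; have [k rek] := Re_neg_pow _ muNR.
have k0 : (0 < k)%N.
  by case: k rek => //; rewrite expr0 (Creal_ReP _ _) ?rpred1// ltr10.
set a := mu ^+ k in rek *.
have b0 : 0 <= - (2 * 'Re a) by rewrite -mulrN mulr_ge0// oppr_ge0 ltW.
exists ('X^k ^+ 2 + (- (2 * 'Re a)) *: 'X^k + (`|a| ^+ 2)%:P).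
have pE u : ('X^k ^+ 2 + (- (2 * 'Re a)) *: 'X^k + (`|a| ^+ 2)%:P).[u]
    = (u ^+ k - a) * (u ^+ k - a^*).
  rewrite !hornerE ReE normCK; set b := a^*; by field.
split.
- rewrite !rpredD ?rpredX ?polyOverX ?polyOverC//; last exact: exprn_ge0.
  by apply: polyOverZ; rewrite ?rpredX ?polyOverX//; exact: b0.
- by rewrite pE subrr mul0r.
- rewrite !hornerE !expr1n mulr1 addrAC !ltr_wpDr ?exprn_ge0//.
(* At a root, [u ^+ k] is [a] or its conjugate, both of modulus [|mu| ^+ k]; as [0 < k], this forces
   [|u| = |mu|]. *)
- move=> u nu; rewrite pE mulf_neq0// subr_eq0.
    apply: contra nu => /eqP /(congr1 Num.norm); rewrite !normrX => /eqP.
    by rewrite eqrXn2.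
  apply: contra nu => /eqP /(congr1 Num.norm); rewrite norm_conjC !normrX => /eqP.
  by rewrite eqrXn2.
Qed.

(* The same polynomial, without its constant term and rescaled, takes the value
   [-1] at [mu]. *)
Lemma nneg_poly_real_value mu : mu \isn't Num.real -> exists2 B, 0 <= B &
  forall s, s \is Num.real ->
    exists h, [/\ h \is a nnegp, h.[mu] = s & h.[1] <= B * `|s|].
Proof.
move=> muNR; have [k rek] := Re_neg_pow _ muNR.
have mu0 : mu != 0 by apply: contraNneq muNR => ->; rewrite real0.
set a := mu ^+ k in rek *.
have b0 : 0 <= - (2 * 'Re a) by rewrite -mulrN mulr_ge0// oppr_ge0 ltW.
have a0 : a != 0 by rewrite expf_neq0.
pose N : {poly C} := (`|a| ^- 2) *: ('X^k ^+ 2 + (- (2 * 'Re a)) *: 'X^k).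
have Nn : N \is a nnegp.
  apply: polyOverZ; first by rewrite unfold_in /= invr_ge0 exprn_ge0.
  rewrite rpredD ?rpredX ?polyOverX //.
  by apply: polyOverZ; rewrite ?rpredX ?polyOverX//; exact: b0.
have Nmu : N.[mu] = -1.
  rewrite !hornerE -/a ReE normCK; field.
  by rewrite conjC_eq0 a0.
have N1 : 0 <= N.[1].
  rewrite !hornerE !expr1n mulr1 mulr_ge0 ?invr_ge0 ?exprn_ge0 ?addr_ge0//.
exists (1 + N.[1]); first by rewrite addr_ge0.
move=> s sR; have [s0|s0] := real_ge0P sR.
  exists s%:P; rewrite polyOverC !hornerC; split=> //.
  by rewrite mulrDl mul1r lerDl mulr_ge0.
exists ((- s) *: N); split.
- by rewrite polyOverZ// unfold_in/= oppr_ge0 ltW.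
- by rewrite hornerZ Nmu mulrN1 opprK.
- by rewrite hornerZ mulrC ler_wpM2r ?oppr_ge0 ?ltW// ltrDr.
Qed.

(** As [mu] is not real, [1] and [mu] span the plane over the reals: with [u = s + t * mu], take
    [h + g * 'X] where [h] and [g] have the real values [s] and [t] at [mu]. A bound linear in [|u|]
    is what lets division of [u] by a power of [mu] shrink the sum of the coefficients. *)
Lemma nneg_poly_value mu : mu \isn't Num.real -> exists2 A, 0 <= A &
  forall u, exists h, [/\ h \is a nnegp, h.[mu] = u & h.[1] <= A * `|u|].
Proof.
move=> muNR; have [B B0 HB] := nneg_poly_real_value _ muNR.
have im0 : 'Im mu != 0 by apply: contra muNR => /eqP/Creal_ImP.
exists (B * (1 + `|mu| / `|'Im mu|) + B / `|'Im mu|).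
  by rewrite addr_ge0// mulr_ge0 ?invr_ge0// addr_ge0 ?divr_ge0.
move=> u; pose t := 'Im u / 'Im mu; pose s := 'Re u - t * 'Re mu.
have tR : t \is Num.real by rewrite rpred_div ?Creal_Im.
have sR : s \is Num.real by apply: rpredB; [exact: Creal_Re | apply: rpredM tR (Creal_Re _)].
have ust : u = s + t * mu.
  rewrite {1}(Crect u) {1}(Crect mu) /s /t.
  by field.
have [h [hn hs h1]] := HB s sR; have [g [gn gt g1]] := HB t tR.
exists (h + g * 'X); split.
- by rewrite rpredD ?rpredM ?polyOverX.
- by rewrite !hornerE hs gt -ust.
- rewrite !hornerE mulrDl; 
  have tle : `|t| <= `|u| / `|'Im mu|.
    rewrite normf_div ler_wpM2r ?invr_ge0//.
    exact: norm_Im_le.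
  apply: lerD.
    apply: le_trans h1 _; rewrite -mulrA ler_wpM2l//.
    rewrite (le_trans (ler_normB _ _))// mulrDl mul1r lerD//.
      exact: norm_Re_le.
    rewrite normrM mulrC mulrAC -mulrA ler_pM// .
    exact: norm_Re_le.
  by apply: le_trans g1 _; rewrite -mulrA ler_wpM2l// mulrC.
Qed.

(** Bernoulli's inequality together with the archimedean property. *)
Lemma expr_unbounded (r K : C) : 1 < r -> K \is Num.real -> exists n, K <= r ^+ n.
Proof.
move=> r1 KR; pose e := r - 1; have e0 : 0 < e by rewrite subr_gt0.
have [n Hn] := archi (K / e); exists n.
have bern m : 1 + m%:R * e <= r ^+ m.
  elim: m => [|m IHm]; first by rewrite mul0r addr0 expr0.
  rewrite exprS; apply: (@le_trans _ _ (r * (1 + m%:R * e))).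
    rewrite -subr_ge0 -natr1.
    have -> : r * (1 + m%:R * e) - (1 + (m%:R + 1) * e) = m%:R * e ^+ 2.
      by rewrite /e; ring.
    by rewrite mulr_ge0// exprn_ge0 ?ltW.
  by rewrite ler_pM2l// (lt_trans _ r1).
apply: le_trans (bern n); rewrite ler_wpDl//.
rewrite -ler_pdivrMr//; apply: le_trans (ltW Hn).
by rewrite real_ler_norm// rpred_div// gtr0_real.
Qed.

Lemma nneg_poly_horner1_ge0 p : p \is a nnegp -> 0 <= p.[1].
Proof.
move=> /polyOverP pn; rewrite horner_coef sumr_ge0// => i _.
by rewrite expr1n mulr1; exact: pn.
Qed.

(* A small multiple of [p] still reaches any value at [mu] when multiplied by
   a high power of ['X], because [1 < `|mu|]. *)
Lemma nneg_poly_small_value mu p u (e : C) : mu \isn't Num.real -> 1 < `|mu| ->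
  p \is a nnegp -> p.[mu] != 0 -> 0 < e ->
  exists h, [/\ h \is a nnegp, (p * h).[mu] = u & (p * h).[1] <= e].
Proof.
move=> muNR mu1 pn pmu e0; have [A A0 HA] := nneg_poly_value _ muNR.
have mu0 : 0 < `|mu| by apply: lt_trans mu1.
have p1 := nneg_poly_horner1_ge0 _ pn.
have [N HN] : exists N, p.[1] * (A * `|u / p.[mu]|) / e <= `|mu| ^+ N.
  by apply: expr_unbounded => //; rewrite ger0_real// divr_ge0 ?mulr_ge0// ltW.
have [h [hn hmu h1]] := HA (u / p.[mu] / mu ^+ N).
exists ('X^N * h); split.
- by rewrite rpredM ?rpredX ?polyOverX.
- rewrite !hornerM hornerXn hmu [_ ^+ _ * _]mulrC divfK ?expf_neq0 -?normr_gt0//.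
  by rewrite mulrC divfK.
- rewrite !hornerM hornerXn expr1n mul1r; apply: le_trans (ler_wpM2l p1 h1) _.
  rewrite normrM normfV normrX (mulrA A) mulrA ler_pdivrMr ?exprn_gt0//.
  by rewrite [e * _]mulrC -ler_pdivrMr.
Qed.

(** Lagrange interpolation: [q i] vanishes at every [l j] with [j != i], but not at [l i] since the
    moduli differ. The sum of the [q i * h i] has the right values with coefficient sum at most [1];
    the missing mass is supplied by a multiple of [ZZ], which vanishes at all the [l i]. *)
Lemma convex_interpolation n (l w : 'I_n -> C) :
  (forall i, l i \isn't Num.real) -> (forall i, 1 < `|l i|) ->
  (forall i j, `|l i| = `|l j| -> i = j) ->
  exists p, [/\ p \is a nnegp, p.[1] = 1 & forall i, p.[l i] = w i].
Proof.
move=> lNR l1 linj.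
have [Z HZ] := choice (fun i => nneg_poly_root _ (lNR i)).
pose q i := \prod_(j | j != i) Z j.
have qn i : q i \is a nnegp by apply: rpred_prod => j _; have [] := HZ j.
have ql i : (q i).[l i] != 0.
  rewrite horner_prod; apply/prodf_neq0 => j ji; have [_ _ _] := HZ j; apply.
  by apply: contra ji => /eqP/linj ->.
have qj i j : i != j -> (q i).[l j] = 0.
  move=> ij; rewrite horner_prod (bigD1 j) 1?eq_sym//=.
  by have [_ -> _ _] := HZ j; rewrite mul0r.
(* The bound [1 / (n + 1)] makes the [n] terms add up to at most [1] at the point [1], also when
   [n = 0]. *)
have [h Hh] := choice (fun i => nneg_poly_small_value _ _ (w i) (n.+1%:R^-1)
  (lNR i) (l1 i) (qn i) (ql i) (ltac:(by rewrite invr_gt0))).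
pose r := \sum_i q i * h i; pose ZZ := \prod_i Z i.
have ZZ1 : 0 < ZZ.[1].
  by rewrite horner_prod prodr_gt0// => i _; have [] := HZ i.
have r1 : r.[1] <= 1.
  rewrite horner_sum (le_trans (ler_sum _ (fun i _ => _ : _ <= n.+1%:R^-1)))//.
    by move=> i _; have [] := Hh i.
  by rewrite sumr_const card_ord -[leLHS]mulr_natl ler_pdivrMr// mul1r ler_nat.
exists (r + ((1 - r.[1]) / ZZ.[1]) *: ZZ); split.
- rewrite rpredD//.
    by apply: rpred_sum => i _; rewrite rpredM//; have [] := Hh i.
  apply: polyOverZ; first by rewrite unfold_in/= divr_ge0 ?subr_ge0// ltW.
  by apply: rpred_prod => i _; have [] := HZ i.
- rewrite hornerD hornerZ divfK ?gt_eqF//; ring.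
- move=> i; have -> : ZZ = Z i * q i by rewrite /ZZ (bigD1 i).
  rewrite hornerD hornerZ [in X in _ + X](hornerM _ _ (l i)).
  have [_ -> _ _] := HZ i; rewrite mul0r mulr0 addr0 horner_sum (bigD1 i)//=.
  rewrite big1 ?addr0; first by have [] := Hh i.
  by move=> j ji; rewrite hornerM qj ?mul0r.
Qed.

End ConvexPolynomials.

(** * Baire's theorem and Hilbert spaces *)

Section Complete.
Variables (C : numClosedFieldType) (E : completeNormedModType C).
Hypothesis archi : archimedean C.

Lemma small_nat (e : C) : 0 < e -> exists n : nat, n.+1%:R^-1 < e.
Proof.
move=> e0; have [n Hn] := archi e^-1; exists n.
rewrite -[e]invrK ltf_pV2 ?posrE ?invr_gt0// (lt_trans _ (_ : n%:R < _))//.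
  by rewrite normfV gtr0_norm// in Hn.
by rewrite ltr_nat.
Qed.

Lemma cauchy_seq_limit (u : nat -> E) :
  (forall e, 0 < e -> exists N, forall n m, (N <= n)%N -> (N <= m)%N ->
    `|u n - u m| < e) ->
  exists l, forall e, 0 < e -> exists N, forall n, (N <= n)%N -> `|l - u n| < e.
Proof.
move=> cu.
have : cvg (u @ \oo).
  apply: cauchy_cvg; apply: cauchy_exP => e e0.
  have [N HN] := cu e e0; exists (u N); exists N => // n /= Nn.
  by rewrite -ball_normE /=; exact: HN.
rewrite cvg_ex => -[l ul]; exists l => e e0.
have [N _ HN] := (@cvgrPdist_lt _ _ _ _ _ _ _ ).1 ul e e0.
by exists N => n Nn; exact: HN.
Qed.

(* MathComp-Analysis states Baire's theorem over a [realType] only. *)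
Lemma baire (O : nat -> set E) :
  (forall n x, O n x -> exists2 r, 0 < r & forall y, `|x - y| < r -> O n y) ->
  (forall n x r, 0 < r -> exists2 y, O n y & `|x - y| < r) ->
  forall x r, 0 < r -> exists2 y, `|x - y| < r & forall n, O n y.
Proof.
move=> Oop Ode x r r0.
(* A pair is a ball with its centre and radius; the next ball lies in [O n], and both its radius and
   the shift of the centre are at most a quarter of the old radius. *)
pose good n (b b' : E * C) := [/\ 0 < b'.2, b'.2 <= b.2 / 4,
  `|b.1 - b'.1| < b.2 / 4 & forall y, `|b'.1 - y| < b'.2 -> O n y].
have step (a : nat * (E * C)) : exists b', 0 < a.2.2 -> good a.1 a.2 b'.
  case: a => n [a s] /=; have [s0|s0] := boolP (0 < s); last by exists (a, s).
  have [b Ob ab] := Ode n a (s / 4) (ltac:(by rewrite divr_gt0)).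
  have [t t0 Ht] := Oop n b Ob.
  have tR : t \is Num.real by exact: gtr0_real.
  have sR : s / 4 \is Num.real by rewrite gtr0_real// divr_gt0.
  have [ts|ts] := real_leP tR sR.
    by exists (b, t).
  exists (b, s / 4) => _; split => //=; first by rewrite divr_gt0.
  by move=> y by_; apply: Ht; exact: lt_trans by_ ts.
have [f Hf] := choice step.
pose fix b n := if n is m.+1 then f (m, b m) else (x, r).
have b0 n : 0 < (b n).2.
  by elim: n => //= n IHn; have [] := Hf (n, b n) IHn.
have Hb n : good n (b n) (b n.+1) by exact: (Hf (n, b n) (b0 n)).
(* The shifts add up to at most half the radius; the other half keeps the limit strictly inside
   every ball. *)
have close n k : `|(b n).1 - (b (n + k)%N).1| <= (b n).2 / 2.
  elim: k n => [|k IHk] n; first by rewrite addn0 subrr normr0 divr_ge0// ltW.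
  have [b1 b2 b3 _] := Hb n.
  rewrite (le_trans (ler_distD (b n.+1).1 _ _))// addnS -addSn.
  have := lerD (ltW b3) (IHk n.+1); move=> /le_trans; apply.
  rewrite [leRHS](_ : _ = (b n).2 / 4 + (b n).2 / 4); last by field.
  rewrite lerD2l (le_trans _ b2)// ler_pdivrMr// ler_peMr ?ler1n//.
  exact: ltW.
have bsmall n : (b n).2 <= r / n.+1%:R.
  elim: n => [|n IHn]; first by rewrite divr1.
  have [_ b2 _ _] := Hb n; apply: le_trans b2 _.
  apply: (@le_trans _ _ (r / n.+1%:R / 4)); first by rewrite ler_wpM2r.
  rewrite -mulrA ler_pM2l// -invfM lef_pV2 ?posrE ?mulr_gt0// -natrM ler_nat.
  by rewrite ltn_Pmulr.
have [|l Hl] := cauchy_seq_limit (fun n => (b n).1).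
  move=> e e0; have [N HN] := small_nat (e / r) (ltac:(by rewrite divr_gt0)).
  have HbN : (b N).2 < e.
    by apply: le_lt_trans (bsmall N) _; rewrite mulrC -ltr_pdivlMr.
  exists N => n m Nn Nm; rewrite (le_lt_trans (ler_distD (b N).1 _ _))//.
  have := close N (n - N)%N; have := close N (m - N)%N; rewrite !subnKC// => h1 h2.
  rewrite distrC in h2; have := lerD h2 h1 => /le_lt_trans; apply.
  by rewrite -splitr.
have lb n : `|(b n).1 - l| < (b n).2.
  have [N HN] := Hl ((b n).2 / 2) (ltac:(by rewrite divr_gt0)).
  rewrite (le_lt_trans (ler_distD (b (n + N)%N).1 _ _))//.
  have h1 := close n N; have := HN (n + N)%N (leq_addl _ _); move=> h2.
  by rewrite distrC in h2; rewrite [ltRHS]splitr ler_ltD.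
exists l; first exact: (lb 0%N).
by move=> n; have [_ _ _] := Hb n; apply; exact: lb.
Qed.

End Complete.

(** * Orthogonality, Riesz representation and total families *)

Section Hilbert.
Variables (C : numClosedFieldType) (E : completeNormedModType C).
Hypothesis archi : archimedean C.
Hypothesis nneg_inf : has_nneg_inf C.
Variable dt : {dot E for @Num.conj C}.
Hypothesis dtN : forall f : E, `|f| ^+ 2 = dt f f.
Implicit Types (x y h : E) (W : set E).

Lemma dotC x y : dt x y = (dt y x)^*.
Proof. by rewrite hermC expr0 mul1r. Qed.

Lemma dotDl x y h : dt (x + y) h = dt x h + dt y h.
Proof. exact: linearDl. Qed.

Lemma dotDr x y h : dt h (x + y) = dt h x + dt h y.
Proof. exact: linearDr. Qed.

Lemma dotBl x y h : dt (x - y) h = dt x h - dt y h.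
Proof. exact: linearBl. Qed.

Lemma dotZl a x h : dt (a *: x) h = a * dt x h.
Proof. exact: linearZl_LR. Qed.

Lemma dotBr x y h : dt h (x - y) = dt h x - dt h y.
Proof. exact: linearBr. Qed.

Lemma dotZr a x h : dt h (a *: x) = a^* * dt h x.
Proof. exact: linearZr_LR. Qed.

Lemma dot_sum n (a : 'I_n -> C) (k : 'I_n -> E) h :
  dt (\sum_i a i *: k i) h = \sum_i a i * dt (k i) h.
Proof.
rewrite (big_morph (dt^~ h) (id1 := 0) (op1 := +%R) _ (linear0l _ _)).
  by apply: eq_bigr => i _; rewrite dotZl.
by move=> x y; exact: dotDl.
Qed.

Lemma dot0_eq0 x : dt x x = 0 -> x = 0.
Proof. by rewrite -dtN => /eqP; rewrite expf_eq0/= normr_eq0 => /eqP. Qed.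

(** Pythagoras for the projection on the line through [y]. It gives Cauchy-Schwarz and the
    approximate orthogonality of near-minimizers of a distance. *)
Lemma norm2_sub_proj x y : y != 0 ->
  `|x - (dt x y / `|y| ^+ 2) *: y| ^+ 2 = `|x| ^+ 2 - `|dt x y| ^+ 2 / `|y| ^+ 2.
Proof.
move=> y0; rewrite (dtN (x - _)) dotBl !dotBr !dotZl !dotZr (dotC y x) -!dtN normCK.
rewrite rmorphM fmorphV rmorphXn /= (CrealP (normr_real y)).
by field; rewrite normr_eq0.
Qed.

Lemma cauchy_schwarz x y : `|dt x y| <= `|x| * `|y|.
Proof.
have [->|y0] := eqVneq y 0; first by rewrite linear0r !normr0 mulr0.
have y2 : 0 < `|y| ^+ 2 by rewrite exprn_gt0 ?normr_gt0.
rewrite -(@ler_pXn2r _ 2) ?nnegrE ?mulr_ge0// exprMn -ler_pdivrMr//.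
by rewrite -subr_ge0 -norm2_sub_proj// exprn_ge0.
Qed.

(** Stated with the midpoint because, for [x - w] and [x - w'] with [w], [w'] in a subspace, the
    midpoint is again [x] minus a point of the subspace. *)
Lemma parallelogram x y :
  `|x - y| ^+ 2 = 2 * `|x| ^+ 2 + 2 * `|y| ^+ 2 - 4 * `|2^-1 *: (x + y)| ^+ 2.
Proof.
rewrite normrZ exprMn !dtN dotBl !dotBr dotDl !dotDr.
by rewrite ger0_norm ?invr_ge0//; field.
Qed.

Definition lin_set W := W 0 /\ forall a x y, W x -> W y -> W (a *: x + y).

(** A sequence in [W] minimizing the distance to [x] is Cauchy by the parallelogram law; with [p]
    its limit, [x - p] is the required vector. As [p] may lie outside [W], orthogonality is passed
    to the limit from the vectors [x - w n]. *)
Lemma exists_orthogonal W x d : lin_set W -> 0 < d -> (forall w, W w -> d <= `|x - w|) ->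
  exists2 h, h != 0 & forall w, W w -> dt w h = 0.
Proof.
move=> [W0 WL] d0 Hd.
have WD u v : W u -> W v -> W (u + v) by move=> ? ?; rewrite -[u]scale1r; exact: WL.
have WZ a u : W u -> W (a *: u) by move=> ?; rewrite -[_ *: _]addr0; exact: WL.
have [|_ [w _ <-]|m Hm mlim] := nneg_inf [set `|x - w| ^+ 2 | w in W].
- by exists (`|x - 0| ^+ 2), 0.
- exact: exprn_ge0.
have Hm' w : W w -> m <= `|x - w| ^+ 2 by move=> Ww; apply: Hm; exists w.
have /choice[w Hw] : forall n, exists v, W v /\ `|x - v| ^+ 2 < m + n.+1%:R^-1.
  move=> n; have [|_ [v Wv <-] Hv] := mlim n.+1%:R^-1; first by rewrite invr_gt0.
  by exists v.
have wclose n k : `|w n - w k| ^+ 2 < 2 * n.+1%:R^-1 + 2 * k.+1%:R^-1.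
  have [Wn wn] := Hw n; have [Wk wk] := Hw k.
  have -> : w n - w k = (x - w k) - (x - w n) by rewrite opprB [RHS]addrC addrA subrK.
  rewrite parallelogram.
  have -> : 2^-1 *: (x - w k + (x - w n)) = x - 2^-1 *: (w k + w n).
    rewrite addrACA -opprD scalerBr; congr (_ - _).
    by rewrite -[x in LHS]scale1r -scalerDl scalerA mulVf ?scale1r// -(natrD _ 1 1) pnatr_eq0.
  have := Hm' (2^-1 *: (w k + w n)) (WZ _ _ (WD _ _ Wk Wn)).
  set A := `|x - w k| ^+ 2 in wk *; set B := `|x - w n| ^+ 2 in wn *; set D := `|_| ^+ 2 => mD.
  have : 0 < 2 * (m + n.+1%:R^-1 - B) + 2 * (m + k.+1%:R^-1 - A) + 4 * (D - m).
    by rewrite ltr_wpDr ?mulr_ge0 ?subr_ge0// addr_gt0// mulr_gt0// subr_gt0.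
  by move=> Q; rewrite -subr_gt0; move: Q; congr (is_true (0 < _)); ring.
have [|p Hp] := cauchy_seq_limit _ _ w.
  move=> e e0; have [N HN] := small_nat _ archi (e ^+ 2 / 4)
    (ltac:(by rewrite divr_gt0 ?exprn_gt0)).
  exists N => n k Nn Nk; rewrite -(@ltr_pXn2r _ 2) ?nnegrE ?(ltW e0)//.
  have le_inv j : (N <= j)%N -> j.+1%:R^-1 < e ^+ 2 / 4.
    by move=> Nj; apply: le_lt_trans HN; rewrite lef_pV2 ?posrE ?ltr0n// ler_nat.
  apply: lt_trans (wclose n k) _.
  have -> : e ^+ 2 = 2 * (e ^+ 2 / 4) + 2 * (e ^+ 2 / 4) by field.
  by rewrite ltrD// ltr_pM2l// le_inv.
exists (x - p).
  apply/eqP => xp; have [N HN] := Hp d d0.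
  have := Hd _ (Hw N).1; have -> : x - w N = p - w N by rewrite (subr0_eq xp).
  by move=> /le_lt_trans/(_ (HN N (leqnn N))); rewrite ltxx.
move=> v Wv; rewrite dotC; apply/eqP; rewrite conjC_eq0 -normr_le0.
have [->|v0] := eqVneq v 0; first by rewrite linear0r normr0.
have v2 : 0 < `|v| ^+ 2 by rewrite exprn_gt0 ?normr_gt0.
(* Adding to [w n] the projection of [x - w n] on [v] lowers the squared distance to [x] by
   [|dt (x - w n) v| ^+ 2 / |v| ^+ 2], yet not below [m]. *)
have ortho n : `|dt (x - w n) v| ^+ 2 <= `|v| ^+ 2 * n.+1%:R^-1.
  have [Wn wn] := Hw n; rewrite mulrC -ler_pdivrMr//.
  have := Hm' (w n + (dt (x - w n) v / `|v| ^+ 2) *: v) (WD _ _ Wn (WZ _ _ Wv)).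
  rewrite opprD addrA norm2_sub_proj// lerBrDr => h.
  by have := le_trans h (ltW wn); rewrite lerD2l.
have vpos : 0 < `|v| by rewrite normr_gt0.
apply: contrapT => /negP; rewrite -real_ltNge ?real0// => D0.
(* Chosen so that two errors, each less than [|v| * e], cannot add up to [|dt (x - p) v|]. *)
pose e := `|dt (x - p) v| / (2 * `|v|).
have e0 : 0 < e by rewrite divr_gt0// mulr_gt0.
have [N HN] := Hp e e0; have [M HM] := small_nat _ archi (e ^+ 2) (ltac:(by rewrite exprn_gt0)).
set j := maxn N M.
have h1 : `|dt (x - w j) v| < `|v| * e.
  rewrite -(@ltr_pXn2r _ 2) ?nnegrE ?mulr_ge0 ?(ltW e0)//.
  apply: le_lt_trans (ortho j) _; rewrite exprMn ltr_pM2l//.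
  by apply: le_lt_trans HM; rewrite lef_pV2 ?posrE ?ltr0n// ler_nat ltnS leq_maxr.
have h2 : `|dt (p - w j) v| < `|v| * e.
  apply: le_lt_trans (cauchy_schwarz _ _) _; rewrite mulrC ltr_pM2l//.
  by apply: HN; rewrite leq_maxl.
have : `|dt (x - p) v| < `|v| * e + `|v| * e.
  have -> : x - p = (x - w j) - (p - w j) by rewrite opprB addrA subrK.
  by rewrite dotBl (le_lt_trans (ler_normB _ _))// ltrD.
have -> : `|v| * e + `|v| * e = `|dt (x - p) v|.
  by rewrite /e; field; rewrite normr_eq0.
by rewrite ltxx.
Qed.

(** If [L x != 0], the bound on [L] keeps [x] at distance at least [|L x| / K] from the kernel, so
    some nonzero [h] is orthogonal to the kernel; a multiple of [h] represents [L], because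
    [f - (L f / L h) *: h] lies in the kernel. *)
Lemma riesz (L : E -> C) (K : C) : scalar L -> (forall f, `|L f| <= K * `|f|) ->
  exists h, forall f, L f = dt f h.
Proof.
move=> Llin LK.
have L0 : L 0 = 0 by have := Llin (-1) 0 0; rewrite scaler0 addr0 mulN1r addNr.
have LZ a f : L (a *: f) = a * L f by have := Llin a f 0; rewrite L0 !addr0.
have LB f g : L (f - g) = L f - L g.
  by rewrite addrC -scaleN1r Llin mulN1r addrC.
have [L1|] := pselect (forall f, L f = 0).
  by exists 0 => f; rewrite linear0r L1.
move=> /existsNP[x /eqP Lx].
have K0 : 0 < K.
  have Lx0 : 0 < `|L x| by rewrite normr_gt0.
  have /lt_le_trans/(_ (LK x)) := Lx0.
  by rewrite pmulr_lgt0// normr_gt0; apply: contraNneq Lx => ->; rewrite L0.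
have [||w Lw|h h0 Hh] := @exists_orthogonal [set f | L f = 0] x (`|L x| / K).
- by split => //= a u v Lu Lv; rewrite Llin Lu Lv mulr0 addr0.
- by rewrite divr_gt0// normr_gt0.
- rewrite ler_pdivrMr// mulrC (le_trans _ (LK _))// LB Lw subr0 //.
exists (((L h)^* / `|h| ^+ 2) *: h) => f.
have h2 : `|h| ^+ 2 != 0 by rewrite expf_neq0// normr_eq0.
have Lh : L h != 0.
  apply: contraNneq h0 => Lh; apply/eqP/dot0_eq0; exact: Hh.
have : dt (f - (L f / L h) *: h) h = 0 by apply: Hh; rewrite /= LB LZ divfK// subrr.
rewrite dotBl dotZl dotZr -dtN rmorphM /= conjCK fmorphV rmorphXn /= (CrealP (normr_real h)).
move=> /subr0_eq ->; field.
by rewrite Lh normr_eq0.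
Qed.

(** Otherwise [x] is at positive distance from the span, and a nonzero vector orthogonal to all the
    [k n] contradicts totality. *)
Lemma span_dense (k : nat -> E) : (forall f, (forall n, dt f (k n) = 0) -> f = 0) ->
  forall x e, 0 < e -> exists n (a : nat -> C), `|x - \sum_(i < n) a i *: k i| < e.
Proof.
move=> ktot x e e0; apply: contrapT => Hx.
have := @exists_orthogonal [set w | exists n (a : nat -> C), w = \sum_(i < n) a i *: k i] x e.
case=> //.
- split; first by exists 0%N, (fun=> 0); rewrite big_ord0.
  move=> c _ _ [n [a ->]] [m [b ->]].
  exists (maxn n m), (fun i => (if (i < n)%N then c * a i else 0) + (if (i < m)%N then b i else 0)).
  under [RHS]eq_bigr do rewrite scalerDl.
  rewrite big_split/= scaler_sumr; congr (_ + _).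
    rewrite (big_ord_widen _ (fun i => c *: (a i *: k i)) (leq_maxl n m)) big_mkcond/=.
    by apply: eq_bigr => i _; case: ifP; rewrite ?scale0r// scalerA.
  rewrite (big_ord_widen _ (fun i => b i *: k i) (leq_maxr n m)) big_mkcond/=.
  by apply: eq_bigr => i _; case: ifP; rewrite ?scale0r.
- move=> w [n [a ->]].
  have eR : e \is Num.real by exact: gtr0_real.
  by case: (real_leP eR (normr_real (x - \sum_(i < n) a i *: k i))) => // lt; case: Hx; exists n, a.
move=> h h0 Hh; case/eqP: h0; apply: ktot => n; rewrite dotC Hh ?conjC0//.
exists n.+1, (fun i => (i == n)%:R); rewrite big_ord_recr/= eqxx scale1r big1 ?add0r//.
by move=> i _; rewrite ltn_eqF// scale0r.
Qed.

End Hilbert.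

(** * Analytic functions *)

Section Analytic.
Variable C : numClosedFieldType.
Implicit Types (f : C -> C) (z w c v : C).

(** Serves as a minimum: the order of [C] is partial, but positive elements are real and hence
    comparable. *)
Lemma pos_lower_bound (x y : C) : 0 < x -> 0 < y -> exists t, [/\ 0 < t, t <= x & t <= y].
Proof.
move=> x0 y0; have [xy|xy] := real_leP (gtr0_real x0) (gtr0_real y0).
  by exists x.
by exists y; split=> //; exact: ltW.
Qed.

Lemma norm_sub_le (E : normedModType C) (x y : E) (b : C) : 0 <= b ->
  (forall e, 0 < e -> `|x - y| < b + e) -> `|x - y| <= b.
Proof.
move=> b0 He; have bR := ger0_real b0.
have [//|lt] := real_leP (normr_real (x - y)) bR.
have /He : 0 < `|x - y| - b by rewrite subr_gt0.
by rewrite addrCA subrr addr0 ltxx.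
Qed.

(** * Taylor remainders and the local form of a power series *)

Section LocalExpansion.
Variables (f : C -> C) (z0 : C) (a : nat -> C).
Hypothesis cvf : \forall z \near z0, series (fun n => a n * (z - z0) ^+ n) @ \oo --> f z.

Let S n z := \sum_(i < n) a i * (z - z0) ^+ i.

Lemma power_series_limit : exists2 r, 0 < r & forall z, `|z - z0| < r ->
  forall e, 0 < e -> exists N, forall n, (N <= n)%N -> `|f z - S n z| < e.
Proof.
have /nbhs_ballP[r r0 Hr] := cvf; exists r => // z zr e e0.
have /Hr cz : ball z0 r z by rewrite -ball_normE /= distrC.
have [N _ HN] := (@cvgrPdist_lt _ _ _ _ _ _ _ ).1 cz e e0.
exists N => n Nn; have := HN n Nn.
by rewrite /= /series /= big_mkord.
Qed.

(** Convergence at [z0 + p] bounds the coefficients by [B / p ^+ n]; within distance [p / 2] the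
    tail is then dominated by a geometric series of ratio at most one half. *)
Lemma power_series_remainder m : exists K, exists2 r, 0 <= K /\ 0 < r &
  forall z, `|z - z0| < r -> `|f z - S m z| <= K * `|z - z0| ^+ m.
Proof.
have [r r0 Hr] := power_series_limit.
have [p p0 pr] : exists2 p : C, 0 < p & p < r.
  by exists (r / 2); rewrite ?divr_gt0// ltr_pdivrMr// ltr_pMr// ltr1n.
(* From index [N] on, a term is the difference of two partial sums within [1] of the limit; the
   finitely many earlier terms are bounded by their sum. *)
have [B B0 HB] : exists2 B, 0 <= B & forall n, `|a n| * p ^+ n <= B.
  have z1r : `|z0 + p - z0| < r.
    by rewrite addrC addKr gtr0_norm.
  have [N HN] := Hr _ z1r 1 ltr01.
  exists (2 + \sum_(i < N) `|a i| * p ^+ i).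
    by rewrite addr_ge0// sumr_ge0// => i _; rewrite mulr_ge0// exprn_ge0// ltW.
  move=> n; have sum0 k : 0 <= \sum_(i < k) `|a i| * p ^+ i.
    by rewrite sumr_ge0// => i _; rewrite mulr_ge0// exprn_ge0// ltW.
  have [Nn|nN] := leqP N n.
    rewrite -[leLHS]addr0 lerD//.
    have -> : `|a n| * p ^+ n = `|S n.+1 (z0 + p) - S n (z0 + p)|.
      rewrite /S big_ord_recr/= [_ + (_ * _)]addrC addrK addrC addKr normrM.
      by rewrite (ger0_norm (exprn_ge0 _ (ltW p0))).
    rewrite (le_trans (ler_distD (f (z0 + p)) _ _))//.
    rewrite -[2]/(1 + 1) lerD// ltW//; last exact: HN.
    by rewrite distrC HN// ltnW.
  rewrite ler_wpDl// (bigD1 (Ordinal nN))//= lerDl sumr_ge0// => i _.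
  by rewrite mulr_ge0// exprn_ge0// ltW.
exists (2 * B / p ^+ m), (p / 2).
  by rewrite divr_gt0// mulr_ge0 ?invr_ge0 ?exprn_ge0 ?mulr_ge0// ltW.
move=> z zp; have [t tp] : exists t : C, `|z - z0| = t * p.
  by exists (`|z - z0| / p); rewrite divfK// gt_eqF.
have t0 : 0 <= t by rewrite -(pmulr_lge0 _ p0) -tp.
have t2 : 2 * t <= 1.
  by rewrite -(ler_pM2r p0) -mulrA -tp mul1r mulrC -ler_pdivlMr// ltW.
have zr : `|z - z0| < r.
  apply: lt_trans zp (le_lt_trans _ pr).
  by rewrite ler_pdivrMr// ler_peMr ?ler1n// ltW.
have tE n : `|a n * (z - z0) ^+ n| <= B * t ^+ n.
  rewrite normrM normrX tp exprMn mulrA mulrAC ler_wpM2r ?exprn_ge0//.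
(* The telescoping bound carries the induction: [t ^+ n <= 2 * t ^+ n - 2 * t ^+ n.+1] because
   [2 * t <= 1]. *)
have part k : `|S (m + k) z - S m z| <= B * (2 * t ^+ m - 2 * t ^+ (m + k)).
  elim: k => [|k IHk]; first by rewrite addn0 !subrr normr0 mulr0.
  rewrite addnS {1}/S big_ord_recr/= -/(S _ z) addrAC (le_trans (ler_normD _ _))//.
  have := lerD IHk (tE (m + k)%N) => /le_trans; apply.
  rewrite -mulrDr ler_wpM2l// -addrA lerD2l exprS.
  rewrite -subr_ge0.
  have -> : - (2 * (t * t ^+ (m + k))) - (- (2 * t ^+ (m + k)) + t ^+ (m + k))
     = (1 - 2 * t) * t ^+ (m + k) by ring.
  by rewrite mulr_ge0 ?subr_ge0// exprn_ge0.
have -> : 2 * B / p ^+ m * `|z - z0| ^+ m = B * (2 * t ^+ m).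
  rewrite tp exprMn mulrA mulrAC divfK ?expf_neq0 ?gt_eqF//; ring.
apply: norm_sub_le; first by rewrite !mulr_ge0 ?exprn_ge0.
move=> e e0; have [N HN] := Hr z zr e e0.
rewrite (le_lt_trans (ler_distD (S (m + N) z) _ _))// addrC ler_ltD//.
  apply: le_trans (part N) _; rewrite ler_wpM2l// gerBl.
  by rewrite mulr_ge0 ?exprn_ge0.
by apply: HN; rewrite leq_addl.
Qed.

Lemma power_series_center : f z0 = a 0%N.
Proof.
have [K [r [K0 r0] Hr]] := power_series_remainder 1.
have := Hr z0; rewrite subrr normr0 => /(_ r0).
rewrite /S big_ord1 expr0 mulr1 expr1 mulr0 normr_le0.
by move=> /eqP/subr0_eq.
Qed.

(** The order is the index of the first nonzero coefficient after [a 0], and the estimate is the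
    remainder one term further; without such a coefficient [f] is locally constant. *)
Lemma power_series_dichotomy :
  (exists2 r, 0 < r & forall z, `|z - z0| < r -> f z = f z0) \/
  exists m c K, exists2 r, [/\ (0 < m)%N, c != 0, 0 <= K & 0 < r] &
    forall z, `|z - z0| < r ->
      `|f z - f z0 - c * (z - z0) ^+ m| <= K * `|z - z0| ^+ m.+1.
Proof.
have [a0|/existsNP[n0 /eqP an0]] := pselect (forall n, a n.+1 = 0).
  left; have [r r0 Hr] := power_series_limit; exists r => // z zr.
  apply/subr0_eq/eqP; rewrite -normr_le0; apply: norm_sub_le => // e e0.
  have [N HN] := Hr z zr e e0; have := HN N.+1 (leqnSn N).
  rewrite add0r power_series_center /S big_ord_recl/= expr0 mulr1.
  by rewrite big1 ?addr0// => i _; rewrite /bump/= add1n a0 mul0r.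
right; have ex : exists n, a n.+1 != 0 by exists n0.
pose m := ex_minn ex.
have [am amin] : a m.+1 != 0 /\ forall i, (i < m)%N -> a i.+1 = 0.
  rewrite /m; case: ex_minnP => k ak kmin; split => // i ik.
  by apply: contraTeq ik => /kmin; rewrite -leqNgt.
have [K [r [K0 r0] Hr]] := power_series_remainder m.+2.
exists m.+1, (a m.+1), K, r => // z zr; have := Hr z zr.
rewrite /S big_ord_recr big_ord_recl/= expr0 mulr1 -power_series_center big1.
  by rewrite addr0 opprD addrA.
by move=> i _; rewrite /bump/= add1n amin// mul0r.
Qed.

End LocalExpansion.

Lemma analytic_continuous (G : set C) f z0 : analytic_on G f -> G z0 ->
  forall e, 0 < e -> exists2 r, 0 < r & forall z, `|z - z0| < r -> `|f z - f z0| < e.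
Proof.
move=> fan /fan[a cvf] e e0.
have [K [r [K0 r0] Hr]] := power_series_remainder _ _ _ cvf 1.
have K1 : 0 < K + 1 by rewrite ltr_wpDl.
have [t [t0 tr te]] := pos_lower_bound _ _ r0 (divr_gt0 e0 K1).
exists t => // z zt; have := Hr z (lt_le_trans zt tr).
rewrite big_ord1 expr0 mulr1 expr1 -(power_series_center _ _ _ cvf).
move=> /le_lt_trans; apply; apply: (@le_lt_trans _ _ ((K + 1) * `|z - z0|)).
  by rewrite ler_wpM2r// lerDl.
by rewrite mulrC -ltr_pdivlMr// (lt_le_trans zt).
Qed.

Lemma analytic_dichotomy (G : set C) f z0 : analytic_on G f -> G z0 ->
  (exists2 r, 0 < r & forall z, `|z - z0| < r -> f z = f z0) \/
  exists m c K, exists2 r, [/\ (0 < m)%N, c != 0, 0 <= K & 0 < r] &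
    forall z, `|z - z0| < r ->
      `|f z - f z0 - c * (z - z0) ^+ m| <= K * `|z - z0| ^+ m.+1.
Proof. by move=> fan /fan[a cvf]; exact: power_series_dichotomy cvf. Qed.

(** The points near which [f] is [c] form an open set [B], which is also closed in [U]: at a limit
    point of [B], a nonzero leading term [b * (x - z) ^+ m] would make [z] an isolated solution of
    [f x = c]. *)
Lemma identity_theorem (G U : set C) f z1 c : analytic_on G f -> U `<=` G ->
  connected U -> U z1 -> (exists2 r, 0 < r & forall z, `|z - z1| < r -> f z = c) ->
  forall z, U z -> f z = c.
Proof.
move=> fan UG cU Uz1 fc.
pose B := [set z | exists2 r, 0 < r & forall w, `|w - z| < r -> f w = c].
have BU z : B z -> f z = c by move=> [r r0]; apply; rewrite subrr normr0.
suff <- : U `&` B = U by move=> z [_ /BU].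
apply: cU; first by exists z1; split.
- exists B => //; rewrite openE => z [r r0 Hr].
  apply/nbhs_ballP; exists (r / 2); first by rewrite /= divr_gt0.
  move=> w; rewrite -ball_normE /= => zw; exists (r / 2); first by rewrite divr_gt0.
  move=> x xw; apply: Hr; rewrite [ltRHS]splitr.
  by rewrite (le_lt_trans (ler_distD w _ _))// ltrD// distrC.
exists (closure B); first exact: closed_closure.
apply/seteqP; split => z [Uz Bz]; split => //; first exact: subset_closure.
have near_B d : 0 < d -> exists2 w, `|w - z| < d & B w.
  move=> d0; have [w [Bw]] := Bz (ball z d) (nbhsx_ballx _ _ d0).
  by rewrite -ball_normE /= distrC => zw; exists w.
have [[r r0 Hr]|[m [b [K [r [m0 b0 K0 r0] Hr]]]]] := analytic_dichotomy _ _ _ fan (UG _ Uz).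
  have [w wz /BU fw] := near_B r r0.
  by exists r => // x /Hr ->; rewrite -(Hr w wz).
have fz : f z = c.
  apply/subr0_eq/eqP; rewrite -normr_le0; apply: norm_sub_le => // e e0.
  have [d d0 Hd] := analytic_continuous _ _ _ fan (UG _ Uz) e e0.
  by have [w wz /BU fw] := near_B d d0; rewrite -[c]fw distrC add0r; exact: Hd.
have K1 : 0 < K + 1 by rewrite ltr_wpDl.
have bn : 0 < `|b| by rewrite normr_gt0.
have [t [t0 tr tb]] := pos_lower_bound _ _ r0 (divr_gt0 bn K1).
have [w wt [s s0 Hs]] := near_B t t0.
(* The point of [B] found near [z] might be [z] itself; then a nearby point is used, as [f] is [c]
   on a whole ball. *)
have [x [xz xt fx]] : exists x, [/\ x != z, `|x - z| < t & f x = c].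
  have [wz|wz] := eqVneq w z; last first.
    by exists w; split=> //; apply: Hs; rewrite subrr normr0.
  have [u [u0 us ut]] := pos_lower_bound _ _ s0 t0.
  have u2 : `|u / 2| < u.
    by rewrite gtr0_norm ?divr_gt0// ltr_pdivrMr// ltr_pMr// ltr1n.
  exists (z + u / 2); split.
  - by rewrite -subr_eq0 addrC addKr mulf_neq0 ?invr_eq0 ?pnatr_eq0// gt_eqF.
  - by rewrite addrC addKr (lt_le_trans u2).
  - by apply: Hs; rewrite wz addrC addKr (lt_le_trans u2).
have x0 : 0 < `|x - z| by rewrite normr_gt0 subr_eq0.
have := Hr x (lt_le_trans xt tr); rewrite fx fz subrr add0r normrN normrM normrX exprSr mulrA.
rewrite -subr_le0 [_ * _ ^+ m]mulrC [K * _]mulrC -!mulrA -mulrBr pmulr_rle0 ?exprn_gt0//.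
rewrite subr_le0 => /le_lt_trans.
have : K * `|x - z| < `|b|.
  apply: (@le_lt_trans _ _ ((K + 1) * `|x - z|)); first by rewrite ler_wpM2r// lerDl.
  by rewrite mulrC -ltr_pdivlMr// (lt_le_trans xt).
by move=> h /(_ _ h); rewrite ltxx.
Qed.

(* A weak form of the open mapping theorem: a non-constant analytic function
   moves in every direction [v]. *)
Lemma analytic_direction (G : set C) f z0 v (e d : C) : analytic_on G f -> G z0 ->
  ~ (exists2 r, 0 < r & forall z, `|z - z0| < r -> f z = f z0) ->
  v != 0 -> 0 < e -> 0 < d ->
  exists z t, [/\ `|z - z0| < d, 0 < t & `|f z - f z0 - t * v| <= e * t].
Proof.
move=> fan Gz0 nc v0 e0 d0.
have [//|[m [c [K [r [m0 c0 K0 r0] Hr]]]]] := analytic_dichotomy _ _ _ fan Gz0.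
(* Along [z0 + x * u] with [0 < x], the leading term is [c * (x * u) ^+ m = x ^+ m * v], so [t] is
   [x ^+ m]; [x] is small enough for the remainder to be at most [e * t]. *)
pose u := m.-root (v / c).
have um : u ^+ m = v / c by rewrite rootCK.
have u0 : 0 < `|u|.
  have : u ^+ m != 0 by rewrite um mulf_neq0// invr_eq0.
  by rewrite expf_eq0 m0 /= normr_gt0.
have vc : 0 < `|v| / `|c| by rewrite divr_gt0 ?normr_gt0.
have K1 : 0 < K + 1 by rewrite ltr_wpDl.
have [s [s0 sd sr]] := pos_lower_bound _ _ d0 r0.
have [h [h0 hs hK]] := pos_lower_bound _ _ s0 (divr_gt0 (divr_gt0 e0 vc) K1).
have [b b0 bh] : exists2 b : C, 0 < b & b < h.
  by exists (h / 2); rewrite ?divr_gt0// ltr_pdivrMr// ltr_pMr// ltr1n.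
have bs : b < s by apply: lt_le_trans hs.
have [x x0 xu] : exists2 x : C, 0 < x & x * `|u| = b.
  by exists (b / `|u|); rewrite ?divr_gt0// divfK// gt_eqF.
have z0E : z0 + x * u - z0 = x * u by rewrite addrC addKr.
have zE : `|x * u| = b by rewrite normrM gtr0_norm.
exists (z0 + x * u), (x ^+ m); split; rewrite ?z0E ?zE ?exprn_gt0//.
  exact: lt_le_trans bs sd.
have := Hr (z0 + x * u); rewrite z0E zE exprMn um => /(_ (lt_le_trans bs sr)).
have -> : c * (x ^+ m * (v / c)) = x ^+ m * v by field.
move=> /le_trans; apply.
have -> : b ^+ m.+1 = x ^+ m * (`|v| / `|c|) * b.
  by rewrite exprSr -{1}xu exprMn -normrX um normf_div.
have -> : K * (x ^+ m * (`|v| / `|c|) * b) = K * b * (`|v| / `|c|) * x ^+ m by ring.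
rewrite ler_pM2r ?exprn_gt0// -ler_pdivlMr//.
apply: (@le_trans _ _ ((K + 1) * b)); first by rewrite ler_pM2r// lerDl.
by rewrite mulrC -ler_pdivlMr// ltW// (lt_le_trans bh).
Qed.

(** * Perturbing a point to control the value of [phi] *)

Section OpenValues.
Variables (G : set C) (phi : C -> C).
Hypothesis Gopen : open G.
Hypothesis phian : analytic_on G phi.
Hypothesis phinc : forall z, G z ->
  ~ (exists2 r, 0 < r & forall w, `|w - z| < r -> phi w = phi z).

Definition outside_ball := [set z | G z /\ 1 < `|phi z|].

Lemma outside_ball_open z : outside_ball z ->
  exists2 r, 0 < r & forall w, `|w - z| < r -> outside_ball w.
Proof.
move=> [Gz z1]; move: Gopen; rewrite openE => /(_ z Gz) /nbhs_ballP[r /= r0 Hr].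
have [s s0 Hs] := analytic_continuous _ _ _ phian Gz (`|phi z| - 1) (ltac:(by rewrite subr_gt0)).
have [t [t0 tr ts]] := pos_lower_bound _ _ r0 s0.
exists t => // w wt; split.
  by apply: Hr; rewrite -ball_normE /= distrC (lt_le_trans wt).
have := Hs w (lt_le_trans wt ts); rewrite distrC ltrBrDr -ltrBrDl => /lt_le_trans; apply.
by rewrite lerBlDr addrC -lerBlDr lerB_dist.
Qed.

(** Induction on [F]: each condition is met by a small move and persists on a ball by continuity.
    Asking for a whole ball leaves room for the next move. *)
Lemma avoid_moduli z0 d (F : seq C) : outside_ball z0 -> 0 < d ->
  exists z r, [/\ 0 < r, outside_ball z & forall w, `|w - z| < r ->
    [/\ `|w - z0| < d, outside_ball w, phi w \isn't Num.real & `|phi w| \notin F]].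
Proof.
move=> Sz0 d0; elim: F => [|b F [z [r [r0 Sz Hr]]]].
  have [s s0 Hs] := outside_ball_open _ Sz0.
  have [t [t0 td ts]] := pos_lower_bound _ _ d0 s0.
  have [z [zt Sz zR]] : exists z, [/\ `|z - z0| < t, outside_ball z & phi z \isn't Num.real].
    have [zR|zR] := boolP (phi z0 \is Num.real); last by exists z0; rewrite subrr normr0.
    (* A move in the direction ['i], with relative error at most one half, makes a real value
       non-real. *)
    have [z [x [zt x0 Hx]]] := analytic_direction _ _ _ 'i 2^-1 t phian Sz0.1 (phinc _ Sz0.1)
      (neq0Ci _) (ltac:(by rewrite invr_gt0)) t0.
    exists z; split => //; first by apply: Hs; exact: lt_le_trans ts.
    apply/negP => zzR; have wR : phi z - phi z0 \is Num.real by rewrite rpredB.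
    have : x <= 2^-1 * x.
      apply: le_trans Hx; rewrite -[x in leLHS](gtr0_norm x0) -normrN.
      have -> : - x = 'Im (phi z - phi z0 - x * 'i).
        by rewrite raddfB /= (Creal_ImP _ wR) add0r mulrC ImMil ?(Creal_ReP _ _)// gtr0_real.
      exact: norm_Im_le.
    have lt : 2^-1 * x < x by rewrite gtr_pMl// invf_lt1// ltr1n.
    by move=> /le_lt_trans/(_ lt); rewrite ltxx.
  have im0 : 0 < `|'Im (phi z)|.
    by rewrite normr_gt0; apply: contra zR => /eqP/Creal_ImP.
  have [p p0 Hp] := analytic_continuous _ _ _ phian Sz.1 _ im0.
  have [q q0 Hq] := outside_ball_open _ Sz.
  have [r1 [r10 r1p r1q]] := pos_lower_bound _ _ p0 q0.
  have tz : 0 < t - `|z - z0| by rewrite subr_gt0.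
  have [r [r0 rt rr1]] := pos_lower_bound _ _ tz r10.
  exists z, r; split => // w wr; have wr1 := lt_le_trans wr rr1.
  split => //.
  - apply: lt_le_trans td; rewrite (le_lt_trans (ler_distD z _ _))//.
    by rewrite -ltrBrDr (lt_le_trans wr).
  - by apply: Hq; exact: lt_le_trans r1q.
  - apply/negP => wR; have := Hp w (lt_le_trans wr1 r1p).
    have -> : `|'Im (phi z)| = `|'Im (phi w - phi z)|.
      by rewrite raddfB /= (Creal_ImP _ wR) sub0r normrN.
    by move=> /lt_le_trans/(_ (norm_Im_le _ _)); rewrite ltxx.
have [z2 [z2r z2b]] : exists z2, `|z2 - z| < r /\ `|phi z2| != b.
  have [zb|zb] := eqVneq `|phi z| b; last by exists z; rewrite subrr normr0.
  have phiz0 : phi z != 0 by rewrite -normr_gt0 (lt_trans ltr01 Sz.2).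
  (* A move in the direction [phi z] increases the modulus: the gain [x * |phi z|] exceeds [x],
     while the error is at most [x / 2]. *)
  have [z2 [x [z2r x0 Hx]]] := analytic_direction _ _ _ (phi z) 2^-1 r phian Sz.1 (phinc _ Sz.1)
    phiz0 (ltac:(by rewrite invr_gt0)) r0.
  exists z2; split => //; rewrite -zb gt_eqF//.
  rewrite -(ltrD2r (2^-1 * x)); apply: (@lt_le_trans _ _ `|(1 + x) * phi z|).
    rewrite normrM gtr0_norm ?addr_gt0// mulrDl mul1r ltrD2l.
    apply: (@lt_trans _ _ x); first by rewrite gtr_pMl// invf_lt1// ltr1n.
    by rewrite ltr_pMr//; exact: Sz.2.
  rewrite (_ : (1 + x) * phi z = phi z2 - (phi z2 - phi z - x * phi z)); last by ring.
  by rewrite (le_trans (ler_normB _ _))// lerD2l.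
have [_ Sz2 _ _] := Hr z2 z2r.
have d2 : 0 < `| `|phi z2| - b| by rewrite normr_gt0 subr_eq0.
have [p p0 Hp] := analytic_continuous _ _ _ phian Sz2.1 _ d2.
have tz : 0 < r - `|z2 - z| by rewrite subr_gt0.
have [s [s0 sr sp]] := pos_lower_bound _ _ tz p0.
exists z2, s; split => // w ws.
have wr : `|w - z| < r.
  rewrite (le_lt_trans (ler_distD z2 _ _))//.
  by rewrite -ltrBrDr (lt_le_trans ws).
have [wd Sw wR wF] := Hr w wr; split => //; rewrite inE negb_or wF andbT.
apply: contraTneq isT => wb; have := Hp w (lt_le_trans ws sp).
rewrite -wb distrC => /(le_lt_trans (ler_dist_dist _ _)).
by rewrite ltxx.
Qed.

End OpenValues.

End Analytic.

(** * Bounded operators and their adjoints *)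

Section Bounded.
Variables (C : numClosedFieldType) (E : completeNormedModType C).
Hypothesis archi : archimedean C.

Lemma continuous_scalar_bounded (L : E -> C) : scalar L -> continuous L ->
  exists K, forall f, `|L f| <= K * `|f|.
Proof.
move=> Llin Lcont.
have L0 : L 0 = 0 by have := Llin (-1) 0 0; rewrite scaler0 addr0 mulN1r addNr.
have LZ a f : L (a *: f) = a * L f by have := Llin a f 0; rewrite L0 !addr0.
have /cvgrPdist_lt /(_ 1 ltr01) := Lcont 0.
move=> /nbhs_ballP[r /= r0 Hr].
exists (2 / r) => f; have [->|f0] := eqVneq f 0; first by rewrite L0 !normr0 mulr0.
have fn : 0 < `|f| by rewrite normr_gt0.
have := Hr ((r / 2 / `|f|) *: f); rewrite -ball_normE /= sub0r normrN normrZ.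
rewrite gtr0_norm ?divr_gt0// divfK ?gt_eqF// => /(_ _)/ltW.
rewrite L0 sub0r normrN LZ normrM gtr0_norm ?divr_gt0// -ler_pdivlMl ?divr_gt0//.
have r2 : r / 2 < r by rewrite ltr_pdivrMr// ltr_pMr// ltr1n.
by move=> /(_ r2); rewrite mulr1 !invf_div mulrC.
Qed.

Variable dt : {dot E for @Num.conj C}.
Hypothesis dtN : forall f : E, `|f| ^+ 2 = dt f f.
Hypothesis nneg_inf : has_nneg_inf C.

Section Adjoint.
Variables (M : E -> E) (k k' : nat -> E).
Hypothesis ktot : forall f, (forall n, dt f (k n) = 0) -> f = 0.
Hypothesis Mk : forall f n, dt (M f) (k n) = dt f (k' n).

Lemma linear_of_weak_adjoint : linear M.
Proof.
move=> a f g; apply/subr0_eq/ktot => n.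
by rewrite dotBl dotDl dotZl !Mk dotDl dotZl subrr.
Qed.

(* Closed-graph argument: [M] is weakly continuous when tested against the
   total family [k], so the sets [`|M f| > n] are open and Baire applies. *)
Lemma bounded_of_weak_adjoint : exists K, forall f, `|M f| <= K * `|f|.
Proof.
have Mlin := linear_of_weak_adjoint.
have M0 : M 0 = 0 by have := Mlin (-1) 0 0; rewrite scaler0 addr0 scaleN1r addNr.
have MZ a f : M (a *: f) = a *: M f by have := Mlin a f 0; rewrite M0 !addr0.
have MD f g : M (f + g) = M f + M g by have := Mlin 1 f g; rewrite !scale1r.
pose O n := [set f | n%:R < `|M f|].
have Oop n x : O n x -> exists2 r, 0 < r & forall y, `|x - y| < r -> O n y.
  rewrite /O /= => nx; have Mx : 0 < `|M x| by exact: le_lt_trans nx.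
  (* With [|M x - g| < e], the inner product of [M x] with [g] still exceeds [n%:R * |g|] in
     modulus. *)
  pose e := `|M x| * (`|M x| - n%:R) / (`|M x| + n%:R).
  have den : 0 < `|M x| + n%:R by rewrite ltr_wpDr.
  have e0 : 0 < e by rewrite divr_gt0// mulr_gt0// subr_gt0.
  have [N [a]] := span_dense _ _ archi nneg_inf _ dtN k ktot (M x) e e0.
  set g := \sum_(i < N) _ => ge.
  pose g' := \sum_(i < N) a i *: k' i.
  (* Since [g] is a combination of the [k i], the functional [dt (M f) g] is continuous in [f]; by
     Cauchy-Schwarz its size at [y] bounds [|M y|] from below. *)
  have adj f : dt (M f) g = dt f g'.
    rewrite (dotC _ _ _ (M f)) (dotC _ _ _ f) !dot_sum; congr (_^*).
    by apply: eq_bigr => i _; rewrite (dotC _ _ _ (k i)) Mk -(dotC _ _ _ (k' i)).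
  have gx : n%:R * `|g| < `|dt (M x) g|.
    have h1 : `|M x| ^+ 2 - `|M x| * `|M x - g| <= `|dt (M x) g|.
      rewrite lerBlDr -[`|M x| ^+ 2]ger0_norm ?exprn_ge0// dtN.
      rewrite -{2}(subrK g (M x)) addrC dotDr (le_trans (ler_normD _ _))// lerD2l.
      exact: cauchy_schwarz.
    have h2 : `|g| <= `|M x| + `|M x - g|.
      by rewrite -{1}(subKr (M x) g) ler_normB.
    apply: le_lt_trans (ler_wpM2l (ler0n _ n) h2) (lt_le_trans _ h1).
    have : (`|M x| + n%:R) * `|M x - g| < `|M x| * (`|M x| - n%:R).
      by rewrite mulrC -ltr_pdivlMr.
    rewrite -subr_gt0 => Q; rewrite -subr_gt0; move: Q; congr (is_true (0 < _)); ring.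
  have g'0 : 0 < `|g'| + 1 by rewrite ltr_wpDl.
  exists ((`|dt (M x) g| - n%:R * `|g|) / (`|g'| + 1)); first by rewrite divr_gt0// subr_gt0.
  move=> y xy; have gy : n%:R * `|g| < `|dt (M y) g|.
    have h : `|dt (x - y) g'| < `|dt (M x) g| - n%:R * `|g|.
      apply: le_lt_trans (cauchy_schwarz _ _ _ dtN _ _) _.
      apply: (@le_lt_trans _ _ (`|x - y| * (`|g'| + 1))); first by rewrite ler_wpM2l// lerDl.
      by rewrite -ltr_pdivlMr.
    rewrite dotBl -!adj in h; rewrite ltrBrDl -ltrBrDr in h.
    apply: lt_le_trans h _; rewrite lerBlDr.
    by rewrite -[in leLHS](subrK (dt (M y) g) (dt (M x) g)) addrC ler_normD.
  have gn0 : 0 < `|g|.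
    rewrite normr_gt0; apply: contraTneq gy => ->.
    by rewrite linear0r !normr0 mulr0 ltxx.
  by rewrite -(ltr_pM2r gn0); apply: lt_le_trans gy _; exact: cauchy_schwarz.
(* No point lies in all the [O n], so one of them fails to be dense and [M] is bounded by [n] on
   some ball. *)
have [n [x [r r0 Hr]]] : exists n x, exists2 r, 0 < r & forall y, `|x - y| < r -> ~ O n y.
  apply: contrapT => nO.
  have [|y _ Oy] := baire _ _ archi O Oop _ 0 1 ltr01.
    move=> n x r r0; apply: contrapT => nx; apply: nO; exists n, x, r => // y xy Oy.
    by apply: nx; exists y.
  have [n] := archi `|M y|; rewrite normr_id => /lt_trans/(_ (Oy n)).
  by rewrite ltxx.
have Mr y : `|x - y| < r -> `|M y| <= n%:R.
  move=> /Hr /negP; rewrite /O /=.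
  by rewrite -real_leNgt ?normr_real ?realn.
exists (4 * n%:R / r) => f; have [->|f0] := eqVneq f 0; first by rewrite M0 !normr0 mulr0.
have fn : 0 < `|f| by rewrite normr_gt0.
have c0 : 0 < r / 2 / `|f| by rewrite !divr_gt0.
have := Mr (x + (r / 2 / `|f|) *: f).
rewrite opprD addrA subrr add0r normrN normrZ gtr0_norm// divfK ?gt_eqF//.
have r2 : r / 2 < r by rewrite ltr_pdivrMr// ltr_pMr// ltr1n.
move=> /(_ r2) h1; have := Mr x; rewrite subrr normr0 => /(_ r0) h2.
have : (r / 2 / `|f|) * `|M f| <= n%:R + n%:R.
  rewrite -[X in X * _](gtr0_norm c0) -normrZ -MZ.
  rewrite -[(_ *: f) in leLHS](addKr x) addrC MD (le_trans (ler_normD _ _))// lerD//.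
  by rewrite -scaleN1r MZ scaleN1r normrN.
rewrite -ler_pdivlMl// => /le_trans; apply.
rewrite le_eqVlt; apply/orP; left; apply/eqP; field.
by rewrite !gt_eqF.
Qed.

Lemma exists_adjoint g : exists h, forall f, dt (M f) g = dt f h.
Proof.
have Mlin := linear_of_weak_adjoint.
have [K HK] := bounded_of_weak_adjoint.
apply: (riesz _ _ archi nneg_inf _ dtN _ (K * `|g|)).
  by move=> a f h; rewrite Mlin dotDl dotZl.
move=> f; apply: le_trans (cauchy_schwarz _ _ _ dtN _ _) _.
by rewrite -mulrA [`|g| * _]mulrC mulrA ler_wpM2r.
Qed.

Lemma adjoint_linear_bounded (T : E -> E) : (forall g f, dt (M f) g = dt f (T g)) ->
  linear T /\ exists2 K, 0 <= K & forall g, `|T g| <= K * `|g|.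
Proof.
move=> MT; split.
  move=> a f g; apply/subr0_eq/(dot0_eq0 _ _ _ dtN).
  move: (X in dt X _) => u.
  by rewrite dotBr dotDr dotZr -!MT dotDr dotZr subrr.
have [K HK] := bounded_of_weak_adjoint.
have [K0|] := boolP (0 <= K).
  exists K => // g; have [->|g0] := eqVneq (T g) 0; first by rewrite normr0 mulr_ge0.
  have gn : 0 < `|T g| by rewrite normr_gt0.
  rewrite -(ler_pM2r gn) -expr2 dtN -MT.
  have D0 : 0 <= dt (M (T g)) g by rewrite MT -dtN exprn_ge0.
  rewrite -[leLHS]ger0_norm//; apply: le_trans (cauchy_schwarz _ _ _ dtN _ _) _.
  by rewrite mulrAC ler_wpM2r.
(* A [K] that is not nonnegative forces [T g = 0], since [0 <= |M (T g)| <= K * |T g|]. *)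
move=> K0; exists 0 => // g; have [->|g0] := eqVneq (T g) 0; first by rewrite normr0 mul0r.
have := le_trans (normr_ge0 _) (HK (T g)); rewrite pmulr_lge0 ?normr_gt0// => K1.
by rewrite K1 in K0.
Qed.

End Adjoint.
End Bounded.

(** * Convex-cyclic operators with many eigenvectors *)

Section ConvexHull.
Variables (C : numClosedFieldType) (E : lmodType C).
Implicit Types (A : set E) (p : {poly C}).

(** Dividing by the total weight, instead of assuming it to be [1], lets the induction apply to the
    first [n] weights; if these all vanish, only the last vector remains. *)
Lemma convex_set_combination A n (c : 'I_n -> C) (v : 'I_n -> E) :
  convex_set A -> (forall i, 0 <= c i) -> (forall i, A (v i)) ->
  0 < \sum_i c i -> A ((\sum_i c i)^-1 *: \sum_i c i *: v i).
Proof.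
move=> cA; elim: n c v => [|n IHn] c v c0 Av; first by rewrite big_ord0 ltxx.
rewrite !big_ord_recr/=; set s := \sum_i _; set w := \sum_i _.
have s0 : 0 <= s by rewrite sumr_ge0.
have [sE|sN0] := eqVneq s 0.
  have -> : w = 0.
    apply: big1 => i _; have /eqP := sE; rewrite psumr_eq0//.
    by move=> /allP/(_ i (mem_index_enum _))/eqP ->; rewrite scale0r.
  rewrite sE !add0r => cn; rewrite scalerA mulVf; last by rewrite gt_eqF.
  by rewrite scale1r.
have {s0 sN0} s0 : 0 < s by rewrite lt_neqAle eq_sym sN0.
move=> sc; set cn := c ord_max in sc *.
have t0 : 0 <= s / (s + cn) by rewrite divr_ge0// ltW.
have t1 : s / (s + cn) <= 1 by rewrite ler_pdivrMr// mul1r lerDl; exact: c0.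
have : A (s / (s + cn) *: (s^-1 *: w) + (1 - s / (s + cn)) *: v ord_max).
  have := cA (s^-1 *: w) (v ord_max) (Itv01 t0 t1).
  by rewrite !inE; apply=> //; exact: IHn.
rewrite !scalerA mulrAC divff ?gt_eqF// mul1r.
rewrite -[X in X - _](divff (lt0r_neq0 sc)) -mulrBl [s + cn]addrC addrK mulrC.
by rewrite -scalerA -scalerDr.
Qed.

Definition poly_op (T : E -> E) p (x : E) := \sum_(i < size p) p`_i *: iter i T x.

Lemma poly_op_convex_hull (T : E -> E) p x : p \is a polyOver (@Num.Def.nneg_num_pred C) ->
  p.[1] = 1 -> convex_hull [set iter n T x | n in [set: nat]] (poly_op T p x).
Proof.
move=> /polyOverP pn p1 A [cA HA].
have sum1 : \sum_(i < size p) p`_i = 1.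
  by rewrite -p1 horner_coef; apply: eq_bigr => i _; rewrite expr1n mulr1.
rewrite /poly_op -[X in A X]scale1r -invr1 -sum1.
apply: convex_set_combination => //; rewrite ?sum1// => i.
  exact: pn.
by apply: HA; exists i.
Qed.

End ConvexHull.

Section Cyclic.
Variables (C : numClosedFieldType) (E : completeNormedModType C).
Hypothesis archi : archimedean C.
Variable q : nat -> C.
Hypothesis qdense : dense_seq _ q.
Variables (T : E -> E) (k : nat -> E) (l : nat -> C) (K : C).
Hypotheses (Tlin : linear T) (K0 : 0 <= K) (TK : forall x, `|T x| <= K * `|x|).
Hypothesis Tk : forall n, T (k n) = l n *: k n.
Hypothesis kspan : forall x e, 0 < e ->
  exists n (a : nat -> C), `|x - \sum_(i < n) a i *: k i| < e.
Hypothesis lNR : forall n, l n \isn't Num.real.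
Hypothesis l1 : forall n, 1 < `|l n|.
Hypothesis linj : forall n m, `|l n| = `|l m| -> n = m.
Implicit Types (p : {poly C}) (x y : E).

Lemma iter_linear n : linear (iter n T).
Proof. by elim: n => [|n IHn] a x y //=; rewrite IHn Tlin. Qed.

Lemma iter_bounded n x : `|iter n T x| <= K ^+ n * `|x|.
Proof.
elim: n => [|n IHn]; first by rewrite expr0 mul1r.
by rewrite iterS exprS -mulrA (le_trans (TK _))// ler_wpM2l.
Qed.

Lemma poly_op_linear p : linear (poly_op _ _ T p).
Proof.
move=> a x y; rewrite /poly_op scaler_sumr -big_split/=.
apply: eq_bigr => i _; rewrite iter_linear scalerDr !scalerA.
by rewrite mulrC.
Qed.

Lemma poly_op_bounded p : exists2 B, 0 <= B & forall x, `|poly_op _ _ T p x| <= B * `|x|.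
Proof.
exists (\sum_(i < size p) `|p`_i| * K ^+ i).
  by rewrite sumr_ge0// => i _; rewrite mulr_ge0// exprn_ge0.
move=> x; rewrite /poly_op mulr_suml (le_trans (ler_norm_sum _ _ _))//.
apply: ler_sum => i _; rewrite normrZ -mulrA ler_wpM2l//.
exact: iter_bounded.
Qed.

Lemma poly_op_eigen p n : poly_op _ _ T p (k n) = p.[l n] *: k n.
Proof.
have itk i : iter i T (k n) = l n ^+ i *: k n.
  elim: i => [|i IHi]; first by rewrite expr0 scale1r.
  have T0 : T 0 = 0 by have := Tlin (-1) 0 0; rewrite scaler0 addr0 scaleN1r addNr.
  have TZ a f : T (a *: f) = a *: T f by have := Tlin a f 0; rewrite T0 !addr0.
  by rewrite iterS IHi TZ Tk scalerA exprSr.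
rewrite /poly_op horner_coef scaler_suml.
by apply: eq_bigr => i _; rewrite itk scalerA.
Qed.

Lemma poly_op_span p n (a : 'I_n -> C) :
  poly_op _ _ T p (\sum_(i < n) a i *: k i) = \sum_(i < n) (p.[l i] * a i) *: k i.
Proof.
have PL := poly_op_linear p.
have P0 : poly_op _ _ T p 0 = 0.
  by have := PL (-1) 0 0; rewrite scaler0 addr0 scaleN1r addNr.
have PD x y : poly_op _ _ T p (x + y) = poly_op _ _ T p x + poly_op _ _ T p y.
  by have := PL 1 x y; rewrite !scale1r.
rewrite (big_morph _ PD P0); apply: eq_bigr => i _.
have := PL (a i) (k i) 0; rewrite P0 !addr0 => ->.
by rewrite poly_op_eigen scalerA mulrC.
Qed.

(** Coefficients are named by their indices in [q], so that the targets form a countable family, as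
    Baire's theorem requires. *)
Definition target (s : seq nat) := \sum_(i < size s) q (nth 0%N s i) *: k i.

Lemma target_dense x e : 0 < e -> exists s, `|x - target s| < e.
Proof.
move=> e0; have e2 : 0 < e / 2 by rewrite divr_gt0.
have [n [a Ha]] := kspan x _ e2.
pose D := \sum_(i < n) `|k i| + 1.
have D0 : 0 < D by rewrite ltr_wpDl// sumr_ge0.
have eD : 0 < e / 2 / D by rewrite divr_gt0.
have /choice[j Hj] : forall i, exists m, `|a i - q m| < e / 2 / D.
  by move=> i; exact: qdense.
exists (mkseq j n); rewrite /target size_mkseq.
rewrite (le_lt_trans (ler_distD (\sum_(i < n) a i *: k i) _ _))//.
rewrite [ltRHS]splitr ltr_leD//.
rewrite -sumrB (le_trans (ler_norm_sum _ _ _))//.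
apply: (@le_trans _ _ (\sum_(i < n) (e / 2 / D) * `|k i|)).
  apply: ler_sum => i _; rewrite nth_mkseq// -scalerBl normrZ.
  by rewrite ler_wpM2r// ltW.
by rewrite -mulr_sumr -mulrA ger_pMr// mulrC ler_pdivrMr// mul1r lerDl.
Qed.

(** Approximate [x] by a combination of enough eigenvectors to cover the target, and interpolate the
    quotients of the target coefficients by those of [y]. *)
Lemma target_transitive s x r : 0 < r -> exists y p,
  [/\ p \is a polyOver (@Num.Def.nneg_num_pred C), p.[1] = 1,
      `|x - y| < r & poly_op _ _ T p y = target s].
Proof.
move=> r0; have r2 : 0 < r / 2 by rewrite divr_gt0.
have [n [a Ha]] := kspan x _ r2.
pose m := maxn n (size s).
pose D := \sum_(i < m) `|k i| + 1.
have D0 : 0 < D by rewrite ltr_wpDl// sumr_ge0.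
pose h := r / 2 / D; have h0 : 0 < h by rewrite divr_gt0.
pose a' i := if (i < n)%N then a i else 0.
(* Only nonzero coefficients allow [p] to reach any prescribed target. *)
pose b i := if a' i == 0 then h else a' i.
pose c i := if (i < size s)%N then q (nth 0%N s i) else 0.
have b0 i : b i != 0 by rewrite /b; case: ifPn => // _; rewrite gt_eqF.
have [p [pn p1 pb]] := convex_interpolation _ archi m (fun i => l i) (fun i => c i / b i)
  (fun i => lNR i) (fun i => l1 i) (fun i j e => ord_inj (linj _ _ e)).
exists (\sum_(i < m) b i *: k i), p; split => //.
  rewrite (le_lt_trans (ler_distD (\sum_(i < n) a i *: k i) _ _))//.
  rewrite [ltRHS]splitr ltr_leD//.
  rewrite (big_ord_widen _ (fun i => a i *: k i) (leq_maxl n (size s))) big_mkcond/=.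
  rewrite -sumrB (le_trans (ler_norm_sum _ _ _))//.
  apply: (@le_trans _ _ (\sum_(i < m) h * `|k i|)).
    apply: ler_sum => i _.
    have -> : (if (i < n)%N then a i *: k i else 0) = a' i *: k i.
      by rewrite /a'; case: ifP; rewrite // scale0r.
    rewrite -scalerBl normrZ ler_wpM2r// /b; case: ifPn => [/eqP ->|_].
      by rewrite sub0r normrN gtr0_norm.
    by rewrite subrr normr0 ltW.
  by rewrite -mulr_sumr /h -mulrA ger_pMr// mulrC ler_pdivrMr// mul1r lerDl.
rewrite poly_op_span /target.
rewrite (big_ord_widen _ (fun i => q (nth 0%N s i) *: k i) (leq_maxr n (size s))) [RHS]big_mkcond/=.
apply: eq_bigr => i _; rewrite pb divfK// /c.
by case: ifP => // _; rewrite scale0r.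
Qed.

(** For each target and tolerance, the vectors sent within the tolerance by some convex polynomial
    in [T] form an open set, as these operators are bounded, and a dense one by [target_transitive].
    A vector in all these sets is convex-cyclic because the targets are dense. *)
Lemma dense_convex_cyclic_vectors x r : 0 < r ->
  exists2 y, `|x - y| < r & convex_cyclic_vector T y.
Proof.
pose convp p := p \is a polyOver (@Num.Def.nneg_num_pred C) /\ p.[1] = 1.
pose P (u : seq nat * nat) := [set x | exists2 p, convp p &
  `|poly_op _ _ T p x - target u.1| < u.2.+1%:R^-1].
(* Numbers that code no pair impose no condition. *)
pose O n := if @unpickle (seq nat * nat)%type n is Some u then P u else setT.
move=> r0; have [||y xy Oy] := baire _ _ archi O _ _ x r r0.
- move=> n z; rewrite /O; case: unpickle => [u|_]; last by exists 1.
  move=> [p cp zp]; have [B B0 HB] := poly_op_bounded p.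
  have B1 : 0 < B + 1 by rewrite ltr_wpDl.
  exists ((u.2.+1%:R^-1 - `|poly_op _ _ T p z - target u.1|) / (B + 1)).
    by rewrite divr_gt0// subr_gt0.
  move=> w zw; exists p => //.
  rewrite (le_lt_trans (ler_distD (poly_op _ _ T p z) _ _))//.
  rewrite -ltrBrDr; apply: le_lt_trans (_ : (B + 1) * `|z - w| < _).
    have -> : poly_op _ _ T p w - poly_op _ _ T p z = poly_op _ _ T p (w - z).
      have h := poly_op_linear p (-1) z w; rewrite !scaleN1r in h.
      by rewrite [w - z]addrC h addrC.
    by rewrite distrC (le_trans (HB _))// distrC ler_wpM2r// lerDl.
  by rewrite mulrC -ltr_pdivlMr.
- move=> n z s s0; rewrite /O; case: unpickle => [u|]; last by exists z; rewrite ?subrr ?normr0.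
  have [y [p [pn p1 zy py]]] := target_transitive u.1 z s s0.
  by exists y => //; exists p => //; rewrite py subrr normr0 invr_gt0.
exists y => // A [z Az] Aop.
move: Aop; rewrite openE => /(_ z Az) /nbhs_ballP[d /= d0 Hd].
have d2 : 0 < d / 2 by rewrite divr_gt0.
have [s Hs] := target_dense z _ d2.
have [m Hm] := small_nat _ archi _ d2.
have := Oy (pickle (s, m)); rewrite /O pickleK => -[p [pn p1] Hp].
exists (poly_op _ _ T p y); split; last exact: poly_op_convex_hull.
apply: Hd; rewrite -ball_normE /= (le_lt_trans (ler_distD (target s) _ _))//.
by rewrite [ltRHS]splitr ltrD// distrC (lt_trans Hp).
Qed.

End Cyclic.

(** * Adjoints of multiplication operators *)

Section Main.
Variable C : numClosedFieldType.
Hypothesis archi : archimedean C.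
Hypothesis nneg_inf : has_nneg_inf C.
Variable q : nat -> C.
Hypothesis qdense : dense_seq _ q.

(* Greedy choice: the [n]-th point is taken in the [n]-th ball of a countable
   basis, off the finitely many moduli already used. *)
Lemma dense_sequence_distinct_moduli (G : set C) (phi : C -> C) :
  open G -> analytic_on G phi ->
  (forall z, G z ->
    ~ (exists2 r, 0 < r & forall w, `|w - z| < r -> phi w = phi z)) ->
  outside_ball _ G phi !=set0 ->
  exists e : nat -> C, [/\ forall n, outside_ball _ G phi (e n),
    forall n, phi (e n) \isn't Num.real,
    forall n m, `|phi (e n)| = `|phi (e m)| -> n = m &
    forall z d, outside_ball _ G phi z -> 0 < d -> exists n, `|z - e n| < d].
Proof.
move=> Gop phian phinc [zs Szs].
pose S := outside_ball _ G phi.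
pose D (u : nat * nat) : set C := [set z | `|q u.1 - z| < u.2.+1%:R^-1].
have step (a : nat * seq C) : exists w, [/\ S w, phi w \isn't Num.real, `|phi w| \notin a.2 &
    forall u, @unpickle (nat * nat)%type a.1 = Some u -> S `&` D u !=set0 -> D u w].
  have [[u [ua [z [Sz Dz]]]]|nD] :=
      pselect (exists u, @unpickle (nat * nat)%type a.1 = Some u /\ S `&` D u !=set0).
    have d0 : 0 < u.2.+1%:R^-1 - `|q u.1 - z| by rewrite subr_gt0.
    have [w [r [r0 Sw /(_ w)]]] := avoid_moduli _ _ _ Gop phian phinc z _ a.2 Sz d0.
    rewrite subrr normr0 => /(_ r0)[wz _ wR wF]; exists w; split => //.
    move=> u' ; rewrite ua => -[<-] _; rewrite /D /= (le_lt_trans (ler_distD z _ _))//.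
    by rewrite [`|z - w|]distrC addrC -ltrBrDr.
  have [w [r [r0 Sw /(_ w)]]] := avoid_moduli _ _ _ Gop phian phinc zs _ a.2 Szs ltr01.
  rewrite subrr normr0 => /(_ r0)[wz _ wR wF]; exists w; split => //.
  by move=> u ua uD; case: nD; exists u.
have [g Hg] := choice step.
pose fix hist n := if n is m.+1 then `|phi (g (m, hist m))| :: hist m else [::].
pose e n := g (n, hist n).
have hist_in i j : (i < j)%N -> `|phi (e i)| \in hist j.
  elim: j => // j IHj; rewrite ltnS leq_eqVlt => /orP[/eqP ->|/IHj ij].
    by rewrite /= inE eqxx.
  by rewrite /= inE ij orbT.
have neq i j : (i < j)%N -> `|phi (e i)| != `|phi (e j)|.
  move=> /hist_in ij; have [_ _ + _] := Hg (j, hist j).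
  by apply: contraNneq => <-.
exists e; split.
- by move=> n; have [] := Hg (n, hist n).
- by move=> n; have [] := Hg (n, hist n).
- move=> n m /eqP nm; have [nm'|mn|//] := ltngtP n m.
    by rewrite (negPf (neq _ _ nm')) in nm.
  by rewrite eq_sym (negPf (neq _ _ mn)) in nm.
- move=> z d Sz d0; have d2 : 0 < d / 2 by rewrite divr_gt0.
  have [j Hj] := small_nat _ archi _ d2.
  have [|i Hi] := qdense z j.+1%:R^-1; first by rewrite invr_gt0.
  exists (pickle (i, j)); have [_ _ _ /(_ (i, j))] := Hg (pickle (i, j), hist (pickle (i, j))).
  rewrite pickleK => /(_ erefl) DS.
  have : D (i, j) (e (pickle (i, j))).
    by apply: DS; exists z; split => //; rewrite /D /= distrC.
  rewrite /D /= => h.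
  rewrite (le_lt_trans (ler_distD (q i) _ _))// [ltRHS]splitr.
  by rewrite ltrD// (lt_trans _ Hj).
Qed.

Variables (G : set C) (H : rkhs G) (phi : C -> C).
Hypothesis Gop : open G.
Hypothesis phimul : multiplier H phi.
Hypothesis phiU : forall U : set C, components G U ->
  ~ exists c, forall z, U z -> phi z = c.
Hypothesis phi1 : forall U : set C, components G U ->
  (phi @` U) `&` [set z | 1 < `|z|] !=set0.

Let S := outside_ball _ G phi.

Lemma multiplier_not_locally_constant z : G z ->
  ~ (exists2 r, 0 < r & forall w, `|w - z| < r -> phi w = phi z).
Proof.
move=> Gz lc; apply: (phiU (connected_component G z)); first by exists z.
exists (phi z) => w.
apply: (identity_theorem _ G _ _ z) lc w; first exact: phimul.1.
- exact: connected_component_sub.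
- exact: component_connected.
- exact: connected_component_refl.
Qed.

Lemma component_meets_outside_ball z : G z ->
  exists2 w, connected_component G z w & S w.
Proof.
move=> Gz; have [|_ [[w Uw <-] w1]] := phi1 (connected_component G z); first by exists z.
by exists w => //; split => //; exact: (connected_component_sub Uw).
Qed.

(** By continuity [f] vanishes on the open set [S], which meets every component of [G]; the identity
    theorem does the rest. *)
Lemma rkhs_eq0_of_dense (e : nat -> C) (f : H) : (forall n, S (e n)) ->
  (forall z d, S z -> 0 < d -> exists n, `|z - e n| < d) ->
  (forall n, ev f (e n) = 0) -> f = 0.
Proof.
move=> Se ed fe; apply/ev_eq0 => z Gz.
have fS w : S w -> ev f w = 0.
  move=> Sw; apply/subr0_eq/eqP; rewrite -normr_le0; apply: norm_sub_le => // d d0.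
  have [r r0 Hr] := analytic_continuous _ _ _ _ (ev_analytic f) Sw.1 d d0.
  have [n] := ed w r Sw r0; rewrite distrC => /Hr.
  by rewrite fe distrC add0r.
have [w Uw Sw] := component_meets_outside_ball z Gz.
have [r r0 Hr] := outside_ball_open _ _ _ Gop phimul.1 w Sw.
apply: (identity_theorem _ G (connected_component G z) (ev f) w 0 (ev_analytic f)) => //.
- exact: connected_component_sub.
- exact: component_connected.
- by exists r => // x /Hr; exact: fS.
- exact: connected_component_refl.
Qed.

Lemma convex_cyclic_vectors_of_multiplier (x : H) (r : C) : 0 < r ->
  exists2 y : H, `|x - y| < r & convex_cyclic_vector (adjoint (mul_op (H := H) phi)) y.
Proof.
(* If [G] is empty, the space is zero and every vector is convex-cyclic. *)
move=> r0; have [[z Gz]|G0] := pselect (G !=set0); last first.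
  have H0 (f : H) : f = 0 by apply/ev_eq0 => z Gz; case: G0; exists z.
  exists x; first by rewrite subrr normr0.
  move=> A [z Az] _; exists z; split => // B [_ HB]; apply: HB; exists 0%N => //.
  by rewrite [RHS]H0 [LHS]H0.
have [w _ Sw] := component_meets_outside_ball z Gz.
have [|e [Se eR einj ed]] := dense_sequence_distinct_moduli G phi Gop phimul.1
  multiplier_not_locally_constant; first by exists w.
(* The kernel functions at the points [e n]. *)
have /choice[k Hk] : forall n, exists k : H, forall f : H, ev f (e n) = dot H f k.
  move=> n; have Gn := (Se n).1.
  have [K HK] := continuous_scalar_bounded _ _ (fun f : H => ev f (e n))
    (@ev_scalar _ _ H _ Gn) (@ev_continuous _ _ H _ Gn).
  exact: (riesz _ _ archi nneg_inf _ (@dot_norm _ _ H) _ K (@ev_scalar _ _ H _ Gn) HK).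
have ktot (f : H) : (forall n, dot H f (k n) = 0) -> f = 0.
  by move=> fk; apply: (rkhs_eq0_of_dense e) => // n; rewrite Hk.
pose M := mul_op (H := H) phi.
have HM f : is_product phi f (M f) by apply: xgetPex; exact: phimul.2.
(* Conjugated because the inner product is conjugate-linear in its second argument. *)
pose l n := (phi (e n))^*.
have Mk f n : dot H (M f) (k n) = dot H f (l n *: k n).
  by rewrite dotZr conjCK -!Hk HM//; exact: (Se n).1.
pose T := adjoint M.
have MT g f : dot H (M f) g = dot H f (T g).
  have := exists_adjoint _ _ archi _ (@dot_norm _ _ H) nneg_inf M k _ ktot Mk g.
  by move=> /(xgetPex 0); exact.
have [Tlin [K K0 TK]] := adjoint_linear_bounded _ _ archi _ (@dot_norm _ _ H) nneg_inf
  M k _ ktot Mk T MT.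
apply: (dense_convex_cyclic_vectors _ _ archi q qdense T k l K) => //.
- move=> n; apply/subr0_eq/(dot0_eq0 _ _ _ (@dot_norm _ _ H)).
  by rewrite dotBr -MT Mk subrr.
- exact: (span_dense _ _ archi nneg_inf _ (@dot_norm _ _ H) k ktot).
- by move=> n; rewrite /l CrealE conjCK eq_sym -CrealE.
- by move=> n; rewrite /l norm_conjC; exact: (Se n).2.
- by move=> n m; rewrite /l !norm_conjC; exact: einj.
Qed.

End Main.

Theorem corollary6p4 (R : realType) (G : set (cplx R)) (H : rkhs G)
    (phi : cplx R -> cplx R) :
  open G ->
  multiplier H phi ->
  (forall U : set (cplx R), components G U ->
    ~ exists c : cplx R, forall z : cplx R, U z -> phi z = c) ->
  (forall U : set (cplx R), components G U ->
    (phi @` U) `&` [set z : cplx R | 1 < `|z|] !=set0) ->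
  convex_cyclic (adjoint (mul_op (H := H) phi)) /\
  dense [set x : H | convex_cyclic_vector (adjoint (mul_op (H := H) phi)) x].
Proof.
move=> Gop phimul phiU phi1.
have [q qdense] := exists_dense_seq_cplx R.
have near := convex_cyclic_vectors_of_multiplier _ (archimedean_cplx R) (has_nneg_inf_cplx R)
  q qdense G H phi Gop phimul phiU phi1.
split; first by have [y _ ?] := near 0 1 ltr01; exists y.
move=> A [x Ax]; rewrite openE => /(_ x Ax) /nbhs_ballP[r /= r0 Hr].
have [y xy Hy] := near x r r0; exists y; split => //.
by apply: Hr; rewrite -ball_normE.
Qed.
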